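(* Let $n\ge 1$ be an integer, and let $$r_0^*\circ\psi_*:\ \mathrm{K}^{T_n\times\mathbb{G}_m\times\mathbb{G}_m}(\mathrm{Comm}_n)\longrightarrow \mathrm{K}^{T_n\times\mathbb{G}_m\times\mathbb{G}_m}(\mathrm{pt})=\mathbb{Z}[q_1^{\pm1},q_2^{\pm1}][z_1^{\pm1},\ldots,z_n^{\pm1}]$$ be the composition of the pushforward along the closed embedding $\psi:\mathrm{Comm}_n\hookrightarrow \mathrm{End}(\mathbb{C}^n)\oplus\mathrm{End}(\mathbb{C}^n)$ of the commuting variety with the (derived) restriction $r_0^*$ to the point $(0,0)\in \mathrm{End}(\mathbb{C}^n)\oplus\mathrm{End}(\mathbb{C}^n)$. Then for any three distinct $i,j,k\in\{1,\ldots,n\}$, the image of $r_0^*\circ\psi_*$ is contained in the ideal $$(z_k-q_1z_j,\ z_j-q_2z_i)\subset \mathbb{Z}[q_1^{\pm1},q_2^{\pm1}][z_1^{\pm1},\ldots,z_n^{\pm1}].$$ Consequently, for the graded map $$\mathrm{KHA}=\bigoplus_{n\ge1}\mathrm{K}^{\mathbb{G}_m\times\mathbb{G}_m}(\mathrm{Coh}_n)\longrightarrow \mathrm{SH}=\bigoplus_{n\ge0}\mathbb{Z}[q_1^{\pm1},q_2^{\pm1}][z_1^{\pm1},\ldots,z_n^{\pm1}]^{\sigma_n}$$ induced by the maps $r_0^*\circ\psi_*$, the image of the degree $n$ component is contained, for every $n\ge 1$, in the intersection of the ideals $(z_k-q_1z_j,\ z_j-q_2z_i)$ over all triples of distinct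 $i,j,k\in\{1,\ldots,n\}$.
   Context: Everything is over $\mathbb{C}$. For an algebraic group $G$ acting on a scheme $X$ of finite type, $\mathrm{K}^G(X)$ denotes the Grothendieck group of $G$-equivariant coherent sheaves on $X$. The commuting variety is $$\mathrm{Comm}_n=\{(X,Y)\in \mathrm{End}(\mathbb{C}^n)\oplus\mathrm{End}(\mathbb{C}^n)\mid [X,Y]=0\}.$$ The group $\mathrm{GL}_n$ acts on $\mathrm{End}(\mathbb{C}^n)\oplus\mathrm{End}(\mathbb{C}^n)$ by simultaneous conjugation, and $\mathbb{G}_m\times\mathbb{G}_m$ acts by scaling, $(t_1,t_2)\cdot(X,Y)=(t_1X,t_2Y)$. These actions commute and preserve $\mathrm{Comm}_n$. Let $T_n\subset\mathrm{GL}_n$ be the maximal torus of diagonal matrices. The variables $z_1,\ldots,z_n$ denote the standard coordinate characters of $T_n$, and $q_1,q_2$ denote the standard characters $t_1,t_2$ of $\mathbb{G}_m\times\mathbb{G}_m$, so that $\mathrm{K}^{T_n\times\mathbb{G}_m\times\mathbb{G}_m}(\mathrm{pt})=\mathbb{Z}[q_1^{\pm1},q_2^{\pm1}][z_1^{\pm1},\ldots,z_n^{\pm1}]$. For example, the line spanned by the matrix unit $E_{ij}$ (with $1$ in position $(i,j)$) in the first, respectively second, copy of $\mathrm{End}(\mathbb{C}^n)$ has $T_n\times\mathbb{G}_m\times\mathbb{G}_m$-weight $q_1z_i/z_j$, respectively $q_2z_i/z_j$. The map $\psi:\mathrm{Comm}_n\to\mathrm{End}(\mathbb{C}^n)\oplus\mathrm{End}(\mathbb{C}^n)$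 is the inclusion, $\psi_*$ is pushforward of equivariant coherent sheaves, $r_0:\mathrm{pt}\to\mathrm{End}(\mathbb{C}^n)\oplus\mathrm{End}(\mathbb{C}^n)$ is the inclusion of the point $(0,0)$, and $r_0^*$ is the derived pullback in equivariant K-theory (alternating sum of Tor sheaves), which is well defined since the ambient space is smooth. The stack $\mathrm{Coh}_n=[\mathrm{Comm}_n/\mathrm{GL}_n]$ is the moduli stack of length $n$ coherent sheaves on $\mathbb{A}^2$, with the induced action of $\mathbb{G}_m\times\mathbb{G}_m$; thus $\mathrm{K}^{\mathbb{G}_m\times\mathbb{G}_m}(\mathrm{Coh}_n)=\mathrm{K}^{\mathrm{GL}_n\times\mathbb{G}_m\times\mathbb{G}_m}(\mathrm{Comm}_n)$. Let $\sigma_n$ be the symmetric group on $n$ letters, which is the Weyl group of $\mathrm{GL}_n$. There is an identification $$\mathrm{K}^{\mathbb{G}_m\times\mathbb{G}_m}(\mathrm{Coh}_n)=\left(\mathrm{K}^{\mathbb{G}_m\times\mathbb{G}_m\times T_n}(\mathrm{Comm}_n)\right)^{\sigma_n}$$ given by restricting equivariance from $\mathrm{GL}_n$ to $T_n$. The degree $n$ component of the map $\mathrm{KHA}\to\mathrm{SH}$ is this identification followed by $r_0^*\circ\psi_*$; it takes values in the $\sigma_n$-invariant Laurent polynomials. $\mathrm{KHA}$ carries the associative K-theoretic Hall algebra product of Schiffmann and Vasserot, $\mathrm{SH}$ carries a shuffle product, and the map $\mathrm{KHA}\to\mathrm{SH}$ is a homomorphism for these products; the products do not enter the claim, which concerns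 only the image of the underlying graded additive map. *)

(* Defs.v *)
From HB Require Import structures.
From mathcomp Require Import all_boot all_order all_algebra.
From mathcomp Require Import boolp classical_sets fsbigop reals.
From mathcomp Require Import complex mpoly.

Set Implicit Arguments.
Unset Strict Implicit.
Unset Printing Implicit Defensive.

Import GRing.Theory.

Local Open Scope classical_set_scope.
Local Open Scope ring_scope.

(* ------------------------------------------------------------------------ *)
(* The Laurent polynomial ring Z[q_1^+-1, q_2^+-1][z_1^+-1, ..., z_n^+-1],  *)
(* realized inside Frac Z[x_0, ..., x_(n+1)], with q_1 = x_0, q_2 = x_1 and *)
(* z_i = x_(2 + i) (indices i of 'I_n start at 0), as the subring of the    *)
(* fractions p / x^m.                                                       *)

Definition ratfun (n : nat) : fieldType := {fraction {mpoly int[2 + n]}}.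

Definition ratvar (n : nat) (i : 'I_(2 + n)) : ratfun n :=
  FracField.tofrac 'X_i.

Definition is_laurent (n : nat) : {pred ratfun n} := fun x =>
  `[< exists (p : {mpoly int[2 + n]}) (m : 'X_{1..2 + n}),
        x = FracField.tofrac p / FracField.tofrac 'X_[m] >].

Lemma mpolyX_frac_neq0 (n : nat) (m : 'X_{1..2 + n}) :
  FracField.tofrac 'X_[m] != 0 :> ratfun n.
Proof.
rewrite tofrac_eq0; apply/eqP => /(congr1 (mcoeff m)) /eqP.
by rewrite mcoeffX eqxx mcoeff0 oner_eq0.
Qed.

Lemma is_laurent_subring (n : nat) : subring_closed (@is_laurent n).
Proof.
split.
- by apply/asboolP; exists 1, 0%MM; rewrite mpolyX0 rmorph1 divr1.
- move=> _ _ /asboolP[p [a ->]] /asboolP[q [b ->]]; apply/asboolP.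
  exists (p * 'X_[b] - q * 'X_[a]), (a + b)%MM.
  by rewrite -mulNr addf_div ?mpolyX_frac_neq0// mpolyXD rmorphB !rmorphM mulNr.
- move=> _ _ /asboolP[p [a ->]] /asboolP[q [b ->]]; apply/asboolP.
  by exists (p * q), (a + b)%MM; rewrite mpolyXD !rmorphM /= mulf_div.
Qed.

HB.instance Definition _ (n : nat) :=
  GRing.isSubringClosed.Build (ratfun n) (@is_laurent n) (@is_laurent_subring n).

Record laurent (n : nat) := Laurent {
  laurent_val :> ratfun n;
  laurent_valP : laurent_val \in @is_laurent n }.

HB.instance Definition _ (n : nat) := [isSub for @laurent_val n].
HB.instance Definition _ (n : nat) := [Choice of laurent n by <:].
HB.instance Definition _ (n : nat) :=
  [SubChoice_isSubComNzRing of laurent n by <:].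

Lemma ratvar_laurent (n : nat) (i : 'I_(2 + n)) : ratvar i \in @is_laurent n.
Proof.
by apply/asboolP; exists 'X_i, 0%MM; rewrite mpolyX0 rmorph1 divr1.
Qed.

Lemma ratvarV_laurent (n : nat) (i : 'I_(2 + n)) :
  (ratvar i)^-1 \in @is_laurent n.
Proof. by apply/asboolP; exists 1, U_(i)%MM; rewrite rmorph1 div1r. Qed.

Lemma ratvarXz_laurent (n : nat) (i : 'I_(2 + n)) (k : int) :
  ratvar i ^ k \in @is_laurent n.
Proof.
case: k => k; first by apply: rpredX; exact: ratvar_laurent.
by rewrite NegzE -exprz_inv; apply: rpredX; exact: ratvarV_laurent.
Qed.

Definition lvar (n : nat) (i : 'I_(2 + n)) : laurent n :=
  Laurent (ratvar_laurent i).

Definition q1 (n : nat) : laurent n := lvar (lshift n (0 : 'I_2)).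
Definition q2 (n : nat) : laurent n := lvar (lshift n (1 : 'I_2)).
Definition zvar (n : nat) (i : 'I_n) : laurent n := lvar (rshift 2 i).

Definition ideal2 (A : comNzRingType) (f g : A) : set A :=
  [set x | exists a b, x = a * f + b * g].

(* ------------------------------------------------------------------------ *)
(* The character lattice of T_n x G_m x G_m: (a, (b1, b2)) stands for       *)
(* z^a q_1^b1 q_2^b2.                                                       *)

Definition weight (n : nat) : choiceType := ('rV[int]_n * (int * int))%type.

Definition ratmono (n : nat) (w : weight n) : ratfun n :=
  ratvar (lshift n (0 : 'I_2)) ^ w.2.1 * ratvar (lshift n (1 : 'I_2)) ^ w.2.2
  * \prod_(i < n) ratvar (rshift 2 i) ^ w.1 0 i.

Lemma ratmono_laurent (n : nat) (w : weight n) :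
  ratmono w \in @is_laurent n.
Proof.
by rewrite !rpredM ?ratvarXz_laurent//; apply: rpred_prod => i _;
  exact: ratvarXz_laurent.
Qed.

Definition lmono (n : nat) (w : weight n) : laurent n :=
  Laurent (ratmono_laurent w).

(* Algebraic groups over C are given by their C-points.                     *)
Definition grp (R : realType) (n : nat) : Type := ('M[R[i]]_n * (R[i] * R[i]))%type.

Definition grp1 (R : realType) (n : nat) : grp R n := (1%:M, (1, 1)).

Definition grpM (R : realType) (n : nat) (g h : grp R n) : grp R n :=
  (g.1 *m h.1, (g.2.1 * h.2.1, g.2.2 * h.2.2)).

Definition GLxGm2 (R : realType) (n : nat) : set (grp R n) :=
  [set g | [/\ g.1 \in unitmx, g.2.1 != 0 & g.2.2 != 0]].

Definition TxGm2 (R : realType) (n : nat) : set (grp R n) :=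
  [set g | GLxGm2 g /\ is_diag_mx g.1].

Definition chi (R : realType) (n : nat) (w : weight n) (g : grp R n) : R[i] :=
  g.2.1 ^ w.2.1 * g.2.2 ^ w.2.2 * \prod_(i < n) g.1 i i ^ w.1 0 i.

(* The regular functions on GL_n x G_m x G_m are the p / (det g t_1 t_2)^k  *)
(* with p a polynomial in the entries of g and in t_1, t_2.                 *)
Definition regfun (R : realType) (n : nat)
    (p : {mpoly R[i][n * n + (1 + 1)]}) (k : nat) (g : grp R n) : R[i] :=
  p.@[row_mx (mxvec g.1) (row_mx g.2.1%:M g.2.2%:M) 0]
    / (\det g.1 * g.2.1 * g.2.2) ^+ k.

(* ------------------------------------------------------------------------ *)
(* V = End(C^n) (+) End(C^n); (genX, genY) is its generic point.            *)

Definition polV (R : realType) (n : nat) : comNzRingType :=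
  {mpoly R[i][n * n + n * n]}.

Definition genX (R : realType) (n : nat) : 'M[polV R n]_n :=
  \matrix_(i, j) 'X_(lshift (n * n) (mxvec_index i j)).
Definition genY (R : realType) (n : nat) : 'M[polV R n]_n :=
  \matrix_(i, j) 'X_(rshift (n * n) (mxvec_index i j)).

Definition commEqs (R : realType) (n : nat) : set (polV R n) :=
  [set f | exists i j,
     f = (genX R n *m genY R n - genY R n *m genX R n) i j].

(* g . f = f o g^-1, where g = (g, t_1, t_2) acts on V by                   *)
(* (X, Y) |-> (t_1 g X g^-1, t_2 g Y g^-1).                                 *)
Definition actpol (R : realType) (n : nat) (g : grp R n) (f : polV R n) :
    polV R n :=
  let conj (t : R[i]) (Z : 'M[polV R n]_n) :=
    map_mx (fun c => c%:MP) (t^-1 *: invmx g.1) *m Z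
      *m map_mx (fun c => c%:MP) g.1 in
  let gen := row_mx (mxvec (conj g.2.1 (genX R n)))
                    (mxvec (conj g.2.2 (genY R n))) in
  f \mPo [tuple gen 0 v | v < n * n + n * n].

(* ------------------------------------------------------------------------ *)
(* For H a closed subgroup of GL_n x G_m x G_m and eqs an H-stable set of   *)
(* equations with zero scheme Z in V, the H-equivariant coherent sheaves on *)
(* the affine scheme Z are the finitely generated C[V]-modules killed by    *)
(* eqs with a compatible rational action of H. The values of esh_act        *)
(* outside H are irrelevant.                                                *)

Record is_esheaf (R : realType) (n : nat) (H : set (grp R n))
    (eqs : set (polV R n)) (M : lmodType (polV R n))
    (act : grp R n -> M -> M) : Prop := IsESheaf {
  esh_fg : exists (r : nat) (e : 'I_r -> M),
    forall m, exists c : 'I_r -> polV R n, m = \sum_(i < r) c i *: e i;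
  esh_eqs : forall (f : polV R n) (m : M), eqs f -> f *: m = 0;
  esh_act1 : forall m, act (grp1 R n) m = m;
  esh_actM : forall g h m, H g -> H h -> act (grpM g h) m = act g (act h m);
  esh_actD : forall g m m', H g -> act g (m + m') = act g m + act g m';
  esh_actZ : forall g (f : polV R n) (m : M), H g -> act g (f *: m) = actpol g f *: act g m;
  esh_rational : forall m, exists (r k : nat) (e : 'I_r -> M)
      (p : 'I_r -> {mpoly R[i][n * n + (1 + 1)]}),
    forall g, H g ->
      act g m = \sum_(i < r) (regfun (p i) k g)%:MP *: e i }.

Record esheaf (R : realType) (n : nat) (H : set (grp R n))
    (eqs : set (polV R n)) := ESheaf {
  esh_mod :> lmodType (polV R n);
  esh_act : grp R n -> esh_mod -> esh_mod;
  esh_axioms : is_esheaf H eqs esh_act }.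

Definition equivariant (R : realType) (n : nat) (H : set (grp R n))
    (eqs : set (polV R n)) (M N : esheaf H eqs) (f : M -> N) : Prop :=
  forall g m, H g -> f (esh_act g m) = esh_act g (f m).

Definition short_exact (R : realType) (n : nat) (H : set (grp R n))
    (eqs : set (polV R n)) (M' M M'' : esheaf H eqs) : Prop :=
  exists (f : {linear M' -> M}) (g : {linear M -> M''}),
    [/\ equivariant f, equivariant g, injective f,
        (forall y, exists x, g x = y)
      & forall x, g x = 0 <-> exists u, f u = x].

(* ------------------------------------------------------------------------ *)
(* The Grothendieck group K^H(Z): formal Z-linear combinations of           *)
(* equivariant coherent sheaves, modulo the axioms of abelian groups and    *)
(* [M] = [M'] + [M''] for short exact sequences. Universe constraints do    *)
(* not allow a choiceType of lmodTypes, so this is not built on {freeg _},  *)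
(* and the elements of the quotient are the equivalence classes.            *)

Definition formalK (R : realType) (n : nat) (H : set (grp R n))
    (eqs : set (polV R n)) : Type := seq (int * esheaf H eqs).

Inductive Keq (R : realType) (n : nat) (H : set (grp R n))
    (eqs : set (polV R n)) : formalK H eqs -> formalK H eqs -> Prop :=
| Keq_refl D : Keq D D
| Keq_sym D E : Keq D E -> Keq E D
| Keq_trans D E F : Keq D E -> Keq E F -> Keq D F
| Keq_cat D D' E E' : Keq D D' -> Keq E E' -> Keq (D ++ E) (D' ++ E')
| Keq_catC D E : Keq (D ++ E) (E ++ D)
| Keq_merge a b M : Keq [:: (a, M); (b, M)] [:: (a + b, M)]
| Keq_zero M : Keq [:: (0, M)] [::]
| Keq_ses M' M M'' : short_exact M' M M'' ->
    Keq [:: (1, M)] [:: (1, M'); (1, M'')].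

Record Kgrp (R : realType) (n : nat) (H : set (grp R n))
    (eqs : set (polV R n)) := KGrp {
  Kset : formalK H eqs -> Prop;
  KsetP : exists D, Kset = Keq D }.

Definition Kof (R : realType) (n : nat) (H : set (grp R n))
    (eqs : set (polV R n)) (D : formalK H eqs) : Kgrp H eqs :=
  KGrp (ex_intro (fun D' => Keq D = Keq D') D erefl).

Definition Krepr (R : realType) (n : nat) (H : set (grp R n))
    (eqs : set (polV R n)) (x : Kgrp H eqs) : formalK H eqs :=
  projT1 (cid (KsetP x)).

(* The additive maps induced on K-groups by an exact functor and by an      *)
(* invariant that is additive on short exact sequences; for such F the      *)
(* choice of a representative is immaterial.                                *)
Definition Kfunctor (R : realType) (n : nat) (H H' : set (grp R n))
    (eqs eqs' : set (polV R n)) (F : esheaf H eqs -> esheaf H' eqs')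
    (x : Kgrp H eqs) : Kgrp H' eqs' :=
  Kof [seq (y.1, F y.2) | y <- Krepr x].

Definition Kinduced (R : realType) (n : nat) (H : set (grp R n))
    (eqs : set (polV R n)) (B : zmodType) (F : esheaf H eqs -> B)
    (x : Kgrp H eqs) : B :=
  \sum_(y <- Krepr x) F y.2 *~ y.1.

(* On modules, pushforward from Z to V only forgets the equations.          *)
Lemma psi_axioms (R : realType) (n : nat) (H : set (grp R n))
    (eqs : set (polV R n)) (M : esheaf H eqs) : is_esheaf H set0 (@esh_act _ _ _ _ M).
Proof. by case: (esh_axioms M) => *; split. Qed.

Definition psi_push (R : realType) (n : nat) (H : set (grp R n))
    (eqs : set (polV R n)) (M : esheaf H eqs) : esheaf H set0 :=
  ESheaf (psi_axioms M).

Lemma resT_axioms (R : realType) (n : nat) (eqs : set (polV R n))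
    (M : esheaf (@GLxGm2 R n) eqs) :
  is_esheaf (@TxGm2 R n) eqs (@esh_act _ _ _ _ M).
Proof.
case: (esh_axioms M) => fg eqs0 a1 aM aD aZ rat; split => //.
- by move=> g h m [Gg _] [Gh _]; exact: aM.
- by move=> g m m' [Gg _]; exact: aD.
- by move=> g f m [Gg _]; exact: aZ.
- move=> m; have [r [k [e [p Hp]]]] := rat m.
  by exists r, k, e, p => g [Gg _]; exact: Hp.
Qed.

Definition resT (R : realType) (n : nat) (eqs : set (polV R n))
    (M : esheaf (@GLxGm2 R n) eqs) : esheaf (@TxGm2 R n) eqs :=
  ESheaf (resT_axioms M).

Definition TsheafV (R : realType) (n : nat) : Type :=
  esheaf (@TxGm2 R n) (set0 : set (polV R n)).

Record resolution (R : realType) (n : nat) (M : TsheafV R n) := Resolution {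
  res_len : nat;
  res_obj : nat -> TsheafV R n;
  res_d : forall i, {linear res_obj i.+1 -> res_obj i};
  res_eps : {linear res_obj 0%N -> M};
  res_free : forall i, exists (r : nat) (e : 'I_r -> res_obj i),
    forall x, exists! c : 'rV[polV R n]_r, x = \sum_(j < r) c 0 j *: e j;
  res_bounded : forall i, (res_len < i)%N -> forall x : res_obj i, x = 0;
  res_d_equiv : forall i, equivariant (res_d i);
  res_eps_equiv : equivariant res_eps;
  res_surj : forall m, exists x, res_eps x = m;
  res_exact0 : forall x, res_eps x = 0 <-> exists y, res_d 0%N y = x;
  res_exact : forall i x, res_d i x = 0 <-> exists y, res_d i.+1 y = x }.

(* m_0 M for the maximal ideal m_0 of the origin, so that the fibre of M at *)
(* the origin is M / m_0 M.                                                 *)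
Definition maxideal_mul (R : realType) (n : nat) (M : lmodType (polV R n)) :
    set M :=
  [set x | exists u : 'I_(n * n + n * n) -> M,
     x = \sum_(v < n * n + n * n) ('X_v : polV R n) *: u v].

(* Tor_i(M, O_0) is the i-th homology of the complex P_* / m_0 P_*, that is *)
(* torZ i / torB i as subspaces of P_i.                                     *)
Definition torZ (R : realType) (n : nat) (M : TsheafV R n) (P : resolution M)
    (i : nat) : set (res_obj P i) :=
  match i return set (res_obj P i) with
  | 0%N => setT
  | j.+1 => [set x | maxideal_mul (res_d P j x)]
  end.

Definition torB (R : realType) (n : nat) (M : TsheafV R n) (P : resolution M)
    (i : nat) : set (res_obj P i) :=
  [set x | exists y, maxideal_mul (x - res_d P i y)].

(* The vectors whose class in Tor_i has T_n x G_m x G_m-weight w.           *)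
Definition torW (R : realType) (n : nat) (M : TsheafV R n) (P : resolution M)
    (i : nat) (w : weight n) : set (res_obj P i) :=
  [set x | torZ x /\ forall g, TxGm2 g ->
     torB (esh_act g x - (chi w g)%:MP *: x)].

(* d is the complex dimension of W / U, for complex subspaces U of W.       *)
Definition is_dimq (R : realType) (n : nat) (M : lmodType (polV R n))
    (W U : set M) (d : nat) : Prop :=
  exists e : 'I_d -> M, (forall j, W (e j)) /\
    forall x, W x -> exists! c : 'rV[R[i]]_d,
      U (x - \sum_(j < d) (c 0 j)%:MP *: e j).

Definition dimq (R : realType) (n : nat) (M : lmodType (polV R n))
    (W U : set M) : nat := xget 0%N [set d | is_dimq W U d].

Definition tor_char (R : realType) (n : nat) (M : TsheafV R n)
    (P : resolution M) (i : nat) : laurent n :=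
  \sum_(w \in [set: weight n]) lmono w *+ dimq (@torW _ _ _ P i w) (@torB _ _ _ P i).

Definition tor_euler (R : realType) (n : nat) (M : TsheafV R n)
    (P : resolution M) : laurent n :=
  \sum_(0 <= i < (res_len P).+1) (-1) ^+ i * tor_char P i.

(* r_0^* [M]: the alternating sum of the Tor_i(M, O_0), computed from any   *)
(* resolution; one exists because V is smooth.                              *)
Definition r0_pull (R : realType) (n : nat) (M : TsheafV R n) : laurent n :=
  xget 0 [set x | exists P : resolution M, x = tor_euler P].

Definition K_T_Comm (R : realType) (n : nat) : Type :=
  Kgrp (@TxGm2 R n) (@commEqs R n).

Definition r0psi (R : realType) (n : nat) : K_T_Comm R n -> laurent n :=
  Kinduced (fun M => r0_pull (psi_push M)).

(* K^(G_m x G_m)(Coh_n), the degree n component of KHA.                     *)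
Definition KHA (R : realType) (n : nat) : Type :=
  Kgrp (@GLxGm2 R n) (@commEqs R n).

Definition KHA_to_T (R : realType) (n : nat) : KHA R n -> K_T_Comm R n :=
  Kfunctor (fun M => resT M).

(* The values are read in the full Laurent polynomial ring, which contains  *)
(* the degree n component of SH as its sigma_n-invariants.                  *)
Definition KHA_to_SH (R : realType) (n : nat) (x : KHA R n) : laurent n :=
  r0psi (KHA_to_T x).

(* Main.v *)
(* The pair v = (E_jk, E_ij) does not commute, and it is fixed by the subtorus T' of
   T_n x G_m x G_m on which z_k = q_1 z_j and z_j = q_2 z_i; the ideal of the theorem
   is the kernel of restriction of characters to T'. For a resolution P of a sheaf
   M on the commuting variety, the terms P_i have bases of weight vectors. Hence
   the alternating sum of the characters of Tor_i(M, O_0) is the alternating sum of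
   the weights of these bases. In restriction to T' it is also the Euler
   characteristic of the fibre of P at v, which is exact since M vanishes near v. *)
From HB Require Import structures.
Require Import Defs.
From mathcomp Require Import all_boot all_order all_algebra.
From mathcomp Require Import boolp classical_sets fsbigop reals.
From mathcomp Require Import complex mpoly.
Import GRing.Theory Num.Theory.
Set Implicit Arguments.
Unset Strict Implicit.
Unset Printing Implicit Defensive.
Local Open Scope classical_set_scope.
Local Open Scope ring_scope.

(** * Graded complexes of vector spaces *)

(** The obstacle is that [res_free] provides bases unrelated to the torus. Rationality splits their
    elements into weight vectors. Among these, vectors whose values form a basis of the fibre at the
    origin are a basis over the whole polynomial ring: dilations contract V to the origin and force
    their determinant to be constant. In such bases the differentials are matrices of semi-invariant
    polynomials, so evaluation at a point fixed by a subgroup yields a complex of vector spaces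
    graded by the weights restricted to that subgroup. One Euler characteristic identity then serves
    twice, at the origin with full weights and at v with restricted ones. Restriction to T' is made
    concrete by a normal form: there q_1 = z_k / z_j and q_2 = z_j / z_i, so every weight is
    replaced by one free of q_1 and q_2, and this substitution changes a Laurent monomial by an
    element of the ideal. The bound is proved for an arbitrary resolution, hence for the one behind
    [r0_pull]. *)

Lemma alternating_telescope (V : nzRingType) (Q : nat -> V) (L : nat) :
  Q 0%N = 0 ->
  \sum_(0 <= i < L) (-1) ^+ i * (Q i + Q i.+1) = - ((-1) ^+ L * Q L).
Proof.
move=> Q0; elim: L => [|L IH]; first by rewrite big_nil Q0 mulr0 oppr0.
by rewrite big_nat_recr //= IH mulrDr addrA addNr add0r exprS mulN1r mulNr opprK.
Qed.

Lemma sum_fibres (V : nmodType) (T : eqType) (I : finType) (wt : I -> T)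
    (f : T -> V) (S : seq T) :
  uniq S -> (forall i, wt i \in S) ->
  \sum_i f (wt i) = \sum_(t <- S) f t *+ #|[pred i | wt i == t]|.
Proof.
move=> uS wtS; under [RHS]eq_bigr do rewrite -sumr_const.
under [RHS]eq_bigr do under eq_bigl do rewrite inE.
rewrite (exchange_big_dep predT) //=; apply: eq_bigr => i _.
under eq_bigl do rewrite eq_sym.
by rewrite -big_filter filter_pred1_uniq ?big_seq1.
Qed.

Section GradedComplex.
Variables (F : fieldType) (T : eqType).

(** Vectors are rows and matrices act on the right, so subspaces are row spaces. Weights are
    arbitrary labels, so that the results apply both to weights and to their reductions on a
    subtorus. *)
Definition wtproj (r : nat) (wt : 'I_r -> T) (t : T) : 'M[F]_r :=
  diag_mx (\row_j (wt j == t)%:R).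

Lemma wtproj_idem r (wt : 'I_r -> T) t :
  wtproj wt t *m wtproj wt t = wtproj wt t.
Proof.
rewrite mulmx_diag; congr diag_mx; apply/rowP => j.
by rewrite !mxE -natrM mulnb andbb.
Qed.

Lemma mxrank_wtproj r (wt : 'I_r -> T) t :
  \rank (wtproj wt t) = #|[pred j | wt j == t]|.
Proof.
set A := [pred j | wt j == t].
pose B : 'M[F]_(#|A|, r) := rowsub enum_val 1%:M.
have BE (i : 'I_#|A|) j : B i j = (enum_val i == j)%:R by rewrite !mxE.
have Bfree : row_free B.
  apply/row_freeP; exists B^T; apply/matrixP => i i'.
  rewrite [LHS]mxE [RHS]mxE (bigD1 (enum_val i)) //=.
  rewrite big1 ?addr0 => [|j /negPf ne].
    by rewrite [B^T _ _]mxE !BE eqxx mul1r (inj_eq enum_val_inj) eq_sym.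
  by rewrite BE eq_sym ne mul0r.
rewrite -(eqP Bfree); apply/eqP; rewrite eqn_leq; apply/andP; split.
  apply/mxrankS/row_subP => j; have [jA|jA] := boolP (j \in A).
    have -> : row j (wtproj wt t) = row (enum_rank_in jA j) B.
      apply/rowP => l; rewrite !mxE enum_rankK_in //.
      by move: jA; rewrite inE => ->.
    exact: row_sub.
  have -> : row j (wtproj wt t) = 0; last exact: sub0mx.
  by apply/rowP => l; rewrite !mxE; move: jA; rewrite inE => /negPf->; rewrite mul0rn.
apply/mxrankS/row_subP => i.
have -> : row i B = row (enum_val i) (wtproj wt t).
  apply/rowP => l; rewrite !mxE.
  by have := enum_valP i; rewrite inE => ->.
exact: row_sub.
Qed.

Lemma sub_wtproj r (wt : 'I_r -> T) t m (U : 'M[F]_(m, r)) :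
  (U <= wtproj wt t)%MS = (U *m wtproj wt t == U).
Proof.
apply/idP/eqP => [/submxP[V ->]|<-]; last exact: submxMl.
by rewrite -mulmxA wtproj_idem.
Qed.

Definition graded_mx r s (wtr : 'I_r -> T) (wts : 'I_s -> T) (D : 'M[F]_(r, s)) :=
  forall j l, D j l != 0 -> wtr j = wts l.

Lemma graded_mx_comm r s (wtr : 'I_r -> T) (wts : 'I_s -> T) (D : 'M[F]_(r, s)) t :
  graded_mx wtr wts D -> wtproj wtr t *m D = D *m wtproj wts t.
Proof.
move=> gr; apply/matrixP => j l; rewrite mul_diag_mx mul_mx_diag !mxE mulrC.
by have [->|/gr->] := eqVneq (D j l) 0; rewrite ?mul0r.
Qed.

(** [D] commutes with the weight projections, so taking the image and taking the weight-[t] part can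
    be exchanged. *)
Lemma mxrank_cap_wtproj r s (wtr : 'I_r -> T) (wts : 'I_s -> T) (D : 'M[F]_(r, s)) t :
  graded_mx wtr wts D -> \rank (wtproj wts t :&: D)%MS = \rank (wtproj wtr t *m D).
Proof.
move=> gr; rewrite (graded_mx_comm t gr); apply/eqP; rewrite eqn_leq.
apply/andP; split; apply: mxrankS.
  have := capmxSl (wtproj wts t) D; rewrite sub_wtproj => /eqP {1}<-.
  by apply: submxMr; exact: capmxSr.
rewrite sub_capmx submxMl -(graded_mx_comm t gr); exact: submxMl.
Qed.

Variables (r : nat -> nat) (wt : forall i, 'I_(r i) -> T).
Variable D : forall i, 'M[F]_(r i.+1, r i).

Definition cycles i : 'M[F]_(r i) :=
  match i return 'M[F]_(r i) with 0%N => 1%:M | j.+1 => kermx (D j) end.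

Definition homology_dim i t : nat :=
  (\rank (wtproj (@wt i) t :&: cycles i)%MS
   - \rank (wtproj (@wt i) t :&: D i)%MS)%N.

Lemma homology_dim0 i t : (cycles i <= D i)%MS -> homology_dim i t = 0%N.
Proof. by move=> ZD; apply/eqP; rewrite subn_eq0; apply/mxrankS/capmxS. Qed.

(** Indexed by the source: [diff_rank i.+1] belongs to [D i]. The value 0 in degree 0 starts the
    telescoping. *)
Definition diff_rank i t : nat :=
  if i is j.+1 then \rank (wtproj (@wt j.+1) t *m D j) else 0%N.

Hypothesis gr : forall i, graded_mx (@wt i.+1) (@wt i) (D i).
Hypothesis DD : forall i, D i.+1 *m D i = 0.

Lemma boundary_sub_cycles i : (D i <= cycles i)%MS.
Proof. by case: i => [|i]; [exact: submx1 | apply/sub_kermxP]. Qed.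

Lemma card_homology_dim i t :
  #|[pred j | @wt i j == t]| = (homology_dim i t + diff_rank i t + diff_rank i.+1 t)%N.
Proof.
rewrite -mxrank_wtproj /homology_dim (mxrank_cap_wtproj t (@gr i)) /=.
have -> : \rank (wtproj (@wt i) t) =
    (\rank (wtproj (@wt i) t :&: cycles i)%MS + diff_rank i t)%N.
  case: i => [|i] /=; last by rewrite addnC mxrank_mul_ker.
  by rewrite capmx1 addn0.
rewrite -addnA (addnC (diff_rank i t)) addnA subnK //.
rewrite -(mxrank_cap_wtproj t (@gr i)).
by apply: mxrankS; apply: capmxS => //; exact: boundary_sub_cycles.
Qed.

(** In each weight, rank-nullity writes the dimension of a term as homology plus outgoing plus
    incoming rank. The ranks telescope, and the last one vanishes because degree [L.+1] has rank
    zero. *)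
Lemma euler_homology (V : nzRingType) (f : T -> V) (S : seq T) L :
  r L.+1 = 0%N -> uniq S -> (forall i j, (i <= L)%N -> @wt i j \in S) ->
  \sum_(0 <= i < L.+1) (-1) ^+ i * (\sum_j f (@wt i j)) =
  \sum_(0 <= i < L.+1) (-1) ^+ i * (\sum_(t <- S) f t *+ homology_dim i t).
Proof.
move=> rL uS wtS; apply/eqP; rewrite -subr_eq0 -sumrB; apply/eqP.
pose Q i := \sum_(t <- S) f t *+ diff_rank i t.
rewrite (eq_big_nat _ _ (F2 := fun i => (-1) ^+ i * (Q i + Q i.+1))); last first.
  move=> i /andP[_ iL]; rewrite -mulrBr; congr (_ * _).
  rewrite (sum_fibres _ uS) => [|j]; last exact: wtS.
  rewrite -big_split -sumrB /=; apply: eq_bigr => t _.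
  by rewrite card_homology_dim -addnA mulrnDr addrAC subrr add0r mulrnDr.
rewrite alternating_telescope; last by apply: big1 => t _; rewrite mulr0n.
suff -> : Q L.+1 = 0 by rewrite mulr0 oppr0.
apply: big1 => t _ /=.
have : (\rank (wtproj (@wt L.+1) t *m D L) <= 0)%N.
  by rewrite (leq_trans (rank_leq_row _)) ?rL.
by rewrite leqn0 => /eqP ->; rewrite mulr0n.
Qed.

End GradedComplex.

(** * Characters of the torus *)

Lemma exprz2_eq1 (K : numFieldType) (z : int) : (2 : K) ^ z = 1 -> z = 0.
Proof.
have pow2 k : (2 : K) ^+ k = 1 -> k = 0%N.
  move=> /eqP; rewrite -natrX -[X in _ == X]/(1%:R) eqr_nat.
  by case: k => // k; rewrite -[X in _ == X](expn0 2) eqn_exp2l.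
case: z => k; first by rewrite -exprnP => /pow2 ->.
by rewrite NegzE -exprnN => /(congr1 (@GRing.inv K)); rewrite invr1 invrK => /pow2.
Qed.

Section Characters.
Variables (R : realType) (n : nat).
Local Notation C := R[i].
Implicit Types (w : weight n) (g h : grp R n).

Lemma TxGm2P g : TxGm2 g <->
  exists (d : 'rV[C]_n) (t1 t2 : C),
    [/\ g = (diag_mx d, (t1, t2)), forall l, d 0 l != 0, t1 != 0 & t2 != 0].
Proof.
split.
  case: g => m [t1 t2] [[/= um t10 t20] /diag_mxP[d dE]].
  exists d, t1, t2; split=> // [|l]; first by rewrite dE.
  have : \det m != 0 by rewrite -unitfE -unitmxE.
  by rewrite dE det_diag => /prodf_neq0; exact.
case=> d [t1 [t2 [-> d0 t10 t20]]]; split; last by apply/diag_mxP; exists d.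
split=> //=; rewrite unitmxE det_diag unitfE.
by apply/prodf_neq0 => l _; exact: d0.
Qed.

Lemma TxGm2_diag_neq0 g l : TxGm2 g -> g.1 l l != 0.
Proof. by move=> /TxGm2P[d [t1 [t2 [-> d0 _ _]]]]; rewrite mxE eqxx; exact: d0. Qed.

Lemma TxGm2_1 : TxGm2 (grp1 R n).
Proof.
apply/TxGm2P; exists (const_mx 1), 1, 1; split; rewrite ?oner_eq0 //.
  by rewrite diag_const_mx.
by move=> l; rewrite mxE oner_eq0.
Qed.

Lemma TxGm2_M g h : TxGm2 g -> TxGm2 h -> TxGm2 (grpM g h).
Proof.
move=> /TxGm2P[d [t1 [t2 [-> d0 t10 t20]]]] /TxGm2P[d' [t1' [t2' [-> d0' t10' t20']]]].
apply/TxGm2P; exists (\row_l (d 0 l * d' 0 l)), (t1 * t1'), (t2 * t2').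
by split; rewrite ?mulf_neq0 /grpM //= ?mulmx_diag // => l; rewrite mxE mulf_neq0.
Qed.

Definition grpV g : grp R n := (invmx g.1, (g.2.1^-1, g.2.2^-1)).

Lemma TxGm2_V g : TxGm2 g -> TxGm2 (grpV g).
Proof.
move=> Hg; move: (Hg) => /TxGm2P[d [t1 [t2 [gE d0 t10 t20]]]].
apply/TxGm2P; exists (\row_l (d 0 l)^-1), t1^-1, t2^-1.
split=> [|l||]; rewrite ?mxE ?invr_eq0 //.
case: Hg => -[gu _ _] _; rewrite /grpV gE /=; congr pair.
apply: (row_free_inj (A := diag_mx d)); rewrite gE /= in gu.
  by rewrite row_free_unit.
rewrite mulVmx // mulmx_diag; apply/matrixP => a b.
by rewrite !mxE mulVf // d0.
Qed.

Lemma grpMV g : TxGm2 g -> grpM g (grpV g) = grp1 R n.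
Proof. by case=> -[gu t1 t2] _; rewrite /grpM /grpV /= mulmxV // !mulfV. Qed.

Lemma chi_neq0 w g : TxGm2 g -> chi w g != 0.
Proof.
move=> /TxGm2P[d [t1 [t2 [-> d0 t10 t20]]]].
rewrite /chi /= !mulf_neq0 ?expfz_neq0 //; apply/prodf_neq0 => l _.
by rewrite expfz_neq0 // mxE eqxx d0.
Qed.

Lemma chi1 w : chi w (grp1 R n) = 1.
Proof.
rewrite /chi /= !exp1rz !mul1r big1 // => l _.
by rewrite mxE eqxx exp1rz.
Qed.

Lemma chiM w g h : TxGm2 g -> TxGm2 h -> chi w (grpM g h) = chi w g * chi w h.
Proof.
move=> /TxGm2P[d [t1 [t2 [-> _ _ _]]]] /TxGm2P[d' [t1' [t2' [-> _ _ _]]]].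
rewrite /chi /grpM /= !expfzMl mulmx_diag.
rewrite [RHS]mulrACA -big_split /=; congr (_ * _); first by rewrite mulrACA.
by apply: eq_bigr => l _; rewrite !mxE eqxx !mulr1n expfzMl.
Qed.

Definition addw w w' : weight n := (w.1 + w'.1, (w.2.1 + w'.2.1, w.2.2 + w'.2.2)).

Lemma chiD w w' g : TxGm2 g -> chi (addw w w') g = chi w g * chi w' g.
Proof.
move=> /TxGm2P[d [t1 [t2 [-> d0 t10 t20]]]].
rewrite /chi /= !expfzDr // [RHS]mulrACA -big_split /=.
congr (_ * _); first by rewrite mulrACA.
by apply: eq_bigr => l _; rewrite !mxE eqxx mulr1n expfzDr.
Qed.

(** Setting one torus coordinate to 2 and the others to 1 isolates one exponent of the quotient
    character, and 2 is not a root of unity. *)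
Lemma chi_inj w w' : (forall g, TxGm2 g -> chi w g = chi w' g) -> w = w'.
Proof.
move=> ww'; pose u : weight n := (w.1 - w'.1, (w.2.1 - w'.2.1, w.2.2 - w'.2.2)).
have uE : w = addw u w'.
  by case: w w' @u {ww'} => a [b1 b2] [a' [b1' b2']]; rewrite /addw /= !subrK.
have u1 g : TxGm2 g -> chi u g = 1.
  move=> Hg; apply: (mulIf (chi_neq0 w' Hg)).
  by rewrite mul1r -chiD // -uE ww'.
have two0 : (2 : C) != 0 by rewrite pnatr_eq0.
suff [u10 [u210 u220]] : u.1 = 0 /\ u.2.1 = 0 /\ u.2.2 = 0.
  move: u10 u210 u220; rewrite /u /= => /subr0_eq e1 /subr0_eq e2 /subr0_eq e3.
  by case: w w' e1 e2 e3 {ww' u uE u1} => a [b1 b2] [a' [b1' b2']] /= -> -> ->.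
split; [apply/rowP => l | split].
- have /u1 : TxGm2 (diag_mx (\row_j (if j == l then 2 else 1 : C)), (1, 1)).
    apply/TxGm2P; eexists; exists 1, 1; split; rewrite ?oner_eq0 // => j.
    by rewrite mxE; case: ifP => _; rewrite ?oner_neq0.
  rewrite /chi /= !exp1rz !mul1r (bigD1 l) //= big1 ?mulr1 => [|j /negPf jl].
    by rewrite !mxE !eqxx => /exprz2_eq1 ->.
  by rewrite !mxE eqxx jl exp1rz.
- have /u1 : TxGm2 (1%:M : 'M[C]_n, (2 : C, 1 : C)).
    apply/TxGm2P; exists (const_mx 1), 2, 1.
    by split; rewrite ?oner_eq0 ?diag_const_mx // => j; rewrite mxE oner_eq0.
  rewrite /chi /= exp1rz mulr1 big1 ?mulr1 => [/exprz2_eq1 //|j _].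
  by rewrite mxE eqxx exp1rz.
- have /u1 : TxGm2 (1%:M : 'M[C]_n, (1 : C, 2 : C)).
    apply/TxGm2P; exists (const_mx 1), 1, 2.
    by split; rewrite ?oner_eq0 ?diag_const_mx // => j; rewrite mxE oner_eq0.
  rewrite /chi /= exp1rz mul1r big1 ?mulr1 => [/exprz2_eq1 //|j _].
  by rewrite mxE eqxx exp1rz.
Qed.

(* Dedekind's argument: a relation evaluated at gh, minus chi w0 h times the
   relation at g, is a shorter relation. *)
Lemma chi_independent (K : nzRingType) (io : {rmorphism C -> K}) (M : lmodType K)
    (S : seq (weight n)) (m : weight n -> M) :
  uniq S ->
  (forall g, TxGm2 g -> \sum_(w <- S) io (chi w g) *: m w = 0) ->
  forall w, w \in S -> m w = 0.
Proof.
elim: S m => // w0 S IH m /andP[w0S uS] rel.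
have mS w1 : w1 \in S -> m w1 = 0.
  move=> w1S; have w10 : w1 <> w0 by move=> e; rewrite e (negPf w0S) in w1S.
  have [h [Hh hne]] : exists h, TxGm2 h /\ chi w1 h != chi w0 h.
    apply: contrapT => no; apply: w10; apply: chi_inj => h Hh.
    by apply/eqP/negPn/negP => ne; apply: no; exists h.
  pose m' w := io (chi w h - chi w0 h) *: m w.
  have /(IH m' uS) : forall g, TxGm2 g -> \sum_(w <- S) io (chi w g) *: m' w = 0.
    move=> g Hg; have := rel _ (TxGm2_M Hg Hh).
    have := congr1 (fun x => io (chi w0 h) *: x) (rel _ Hg).
    rewrite scaler0 !big_cons scalerDr !chiM // scaler_sumr => r1 r2.
    rewrite -[RHS](subrr 0) -[X in _ = X - _]r2 -[X in _ = _ - X]r1.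
    rewrite addrAC opprD addrA scalerA -rmorphM mulrC subrr.
    rewrite sub0r addrC -sumrB big_seq_cond [RHS]big_seq_cond.
    apply: eq_bigr => w _; rewrite /m' !scalerA -!rmorphM -scalerBl -rmorphB.
    by rewrite chiM // mulrBr [chi w0 h * _]mulrC.
  move=> /(_ _ w1S) /(congr1 (fun x => io (chi w1 h - chi w0 h)^-1 *: x)).
  by rewrite /m' scaler0 scalerA -rmorphM mulVf ?subr_eq0 // rmorph1 scale1r.
move=> w; rewrite inE => /orP[/eqP->|/mS //].
have := rel _ TxGm2_1; rewrite big_cons chi1 rmorph1 scale1r.
by rewrite big_seq big1 ?addr0 // => v /mS ->; rewrite scaler0.
Qed.

End Characters.

(** * Dimensions of quotients computed as ranks *)

Section Dimq.
Variables (R : realType) (n : nat) (M : lmodType (polV R n)) (r : nat).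
Local Notation C := R[i].
Variables (kap : {additive M -> 'rV[C]_r}).
Hypothesis kapZ : forall (c : C) x, kap (c%:MP *: x) = c *: kap x.
Hypothesis kap_surj : forall u, exists x, kap x = u.

(** [dimq] picks its value by [xget], so two facts are combined: every admissible dimension is the
    difference of ranks, and this difference is admissible. [kap] will be the reduction to the fibre
    at the origin. *)
Lemma dimq_rank (W U : set M) m1 m2 (Wm : 'M[C]_(m1, r)) (Um : 'M[C]_(m2, r)) :
  (forall x, W x <-> (kap x <= Wm)%MS) ->
  (forall x, U x <-> (kap x <= Um)%MS) ->
  (Um <= Wm)%MS ->
  dimq W U = (\rank Wm - \rank Um)%N.
Proof.
move=> WE UE UW.
have kapsum d (e : 'I_d -> M) (c : 'rV[C]_d) :
    kap (\sum_(j < d) (c 0 j)%:MP *: e j) = c *m \matrix_j kap (e j).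
  rewrite raddf_sum mulmx_sum_row; apply: eq_bigr => j _.
  by rewrite /= kapZ rowK.
have uniqd d : is_dimq W U d -> d = (\rank Wm - \rank Um)%N.
  case=> e [eW edec]; pose E := \matrix_j kap (e j).
  (* Uniqueness of the coordinates of 0 makes the images of the [e j] independent modulo [Um]. *)
  have E0 (c : 'rV_d) : (c *m E <= Um)%MS -> c = 0.
    move=> cE; have [|c' [_ c'u]] := edec 0; first by apply/WE; rewrite raddf0 sub0mx.
    have <- : c' = c by apply: c'u; apply/UE; rewrite raddfB /= kapsum raddf0 sub0r eqmx_opp.
    by apply: c'u; apply/UE; rewrite raddfB /= kapsum raddf0 sub0r eqmx_opp mul0mx sub0mx.
  have EF : row_free E by apply: inj_row_free => c cE; apply: E0; rewrite cE sub0mx.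
  have EU : (E :&: Um)%MS = 0.
    apply/eqP/rowV0P => v; rewrite sub_capmx => /andP[/submxP[c vE] vU].
    by rewrite vE (E0 c) ?mul0mx // -vE.
  have <- : \rank (E + Um)%MS = \rank Wm.
    apply/eqmx_rank/andP; split.
      by rewrite addsmx_sub UW andbT; apply/row_subP => j; rewrite rowK; apply/WE.
    apply/row_subP => j; have [x xE] := kap_surj (row j Wm).
    have [|c [/UE]] := edec x; first by apply/WE; rewrite xE row_sub.
    rewrite raddfB /= kapsum xE => le _.
    rewrite -(subrK (c *m E) (row j Wm)) addmx_sub //.
      exact: submx_trans le (addsmxSr _ _).
    exact: submx_trans (submxMl _ _) (addsmxSl _ _).
  by rewrite (mxrank_disjoint_sum EU) (eqP EF) addnK.
have isd : is_dimq W U (\rank Wm - \rank Um).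
  have -> : (\rank Wm - \rank Um)%N = \rank (Wm :\: Um)%MS.
    rewrite -(mxrank_cap_compl Wm Um).
    by rewrite (capmx_idPr UW) addKn.
  (* A complement of [Um] in [Wm] supplies representatives of a basis of the quotient. *)
  pose B := row_base (Wm :\: Um)%MS.
  have [e eE] : exists e : 'I_(\rank (Wm :\: Um)%MS) -> M, forall j, kap (e j) = row j B.
    have [e eP] := boolp.choice (fun j => kap_surj (row j B)).
    by exists e.
  have EB : \matrix_j kap (e j) = B by apply/row_matrixP => j; rewrite rowK eE.
  have BW : (B <= Wm)%MS by rewrite eq_row_base diffmxSl.
  exists e; split=> [j|x /WE xW].
    by apply/WE; rewrite eE (submx_trans (row_sub _ _)).
  have : (kap x <= B + Um)%MS.
    apply: submx_trans xW _; rewrite -(addsmx_diff_cap_eq Wm Um).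
    by apply: addsmxS; [rewrite eq_row_base | exact: capmxSr].
  move=> /sub_addsmxP[[c u] /= xE]; exists c; split.
    by apply/UE; rewrite raddfB /= kapsum EB xE addrC addKr submxMl.
  move=> c' /UE; rewrite raddfB /= kapsum EB xE => le.
  apply/eqP; rewrite -subr_eq0; apply/eqP.
  apply: (row_free_inj (row_base_free (Wm :\: Um)%MS)); rewrite mul0mx.
  apply/eqP; rewrite -submx0 -(capmx_diff Wm Um) sub_capmx.
  rewrite -{1}(eq_row_base (Wm :\: Um)%MS) submxMl /=.
  rewrite mulmxBl -(addrK (u *m Um) (_ - _)) addmx_sub ?eqmx_opp ?submxMl //.
  by rewrite addrAC.
rewrite /dimq; case: xgetP => [d _ /uniqd //|no].
by case: (no _ isd).
Qed.

End Dimq.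

(** * Evaluation of polynomials and the torus action *)

Lemma map_conj_pair (S S' : nzRingType) (f : {rmorphism S -> S'}) n
    (P Q Z P' Q' Z' : 'M[S]_n) :
  map_mx f (row_mx (mxvec (P *m Z *m Q)) (mxvec (P' *m Z' *m Q'))) =
  row_mx (mxvec (map_mx f P *m map_mx f Z *m map_mx f Q))
         (mxvec (map_mx f P' *m map_mx f Z' *m map_mx f Q')).
Proof. by rewrite map_row_mx !map_mxvec !map_mxM. Qed.

Section PolynomialAction.
Variables (R : realType) (n : nat).
Local Notation C := R[i].
Local Notation A := (polV R n).
Implicit Types (g h : grp R n) (f : A) (X Y : 'M[C]_n).

Definition eval_at X Y : {rmorphism A -> C} := meval (row_mx (mxvec X) (mxvec Y) 0).

(** Copied from the body of [actpol], so that [actpolE] holds by conversion and the action becomes a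
    ring morphism. *)
Definition act_gen g : 'rV[A]_(n * n + n * n) :=
  let conj (t : C) (Z : 'M[A]_n) :=
    map_mx (fun c => c%:MP) (t^-1 *: invmx g.1) *m Z
      *m map_mx (fun c => c%:MP) g.1 in
  row_mx (mxvec (conj g.2.1 (genX R n))) (mxvec (conj g.2.2 (genY R n))).

Definition act_coords g : (n * n + n * n).-tuple A :=
  [tuple act_gen g 0 v | v < n * n + n * n].

Definition act_poly g : {rmorphism A -> A} := comp_mpoly (act_coords g).

Lemma actpolE g f : actpol g f = act_poly g f.
Proof. by []. Qed.

Lemma act_polyC g (c : C) : act_poly g c%:MP = c%:MP.
Proof. exact: comp_mpolyC. Qed.

Lemma eval_atC X Y (c : C) : eval_at X Y c%:MP = c.
Proof. exact: mevalC. Qed.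

Lemma eval_genX X Y : map_mx (eval_at X Y) (genX R n) = X.
Proof. by apply/matrixP => a b; rewrite !mxE [LHS]mevalXU row_mxEl mxvecE. Qed.

Lemma eval_genY X Y : map_mx (eval_at X Y) (genY R n) = Y.
Proof. by apply/matrixP => a b; rewrite !mxE [LHS]mevalXU row_mxEr mxvecE. Qed.

Lemma eval_act_gen g X Y :
  map_mx (eval_at X Y) (act_gen g) =
  row_mx (mxvec ((g.2.1^-1 *: invmx g.1) *m X *m g.1))
         (mxvec ((g.2.2^-1 *: invmx g.1) *m Y *m g.1)).
Proof.
have evC B : map_mx (eval_at X Y) (map_mx (fun c : C => c%:MP) B) = B :> 'M_n.
  by apply/matrixP => a b; rewrite !mxE [LHS]mevalC.
by rewrite /act_gen map_conj_pair !evC eval_genX eval_genY.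
Qed.

Lemma eval_act_poly g X Y f :
  eval_at X Y (act_poly g f) =
  eval_at ((g.2.1^-1 *: invmx g.1) *m X *m g.1)
          ((g.2.2^-1 *: invmx g.1) *m Y *m g.1) f.
Proof.
rewrite /eval_at -eval_act_gen /act_poly /= comp_mpoly_meval.
by apply: meval_eq => v; rewrite tnth_mktuple [RHS]mxE.
Qed.

(** The two equations say, without inverses, that [g] fixes the pair (X, Y). *)
Lemma eval_act_poly_fixed g X Y f : TxGm2 g ->
  X *m g.1 = g.2.1 *: g.1 *m X -> Y *m g.1 = g.2.2 *: g.1 *m Y ->
  eval_at X Y (act_poly g f) = eval_at X Y f.
Proof.
move=> [[gu t1 t2] _] Xg Yg; rewrite eval_act_poly -!mulmxA Xg Yg.
rewrite -!scalemxAl !scalemxAr !scalerA !mulVf // !scale1r.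
by rewrite !mulKmx.
Qed.

Lemma eval_act_poly0 g f : eval_at 0 0 (act_poly g f) = eval_at 0 0 f.
Proof. by rewrite eval_act_poly !mulmx0 !mul0mx. Qed.

(** The inverse of 2 appears because [g] acts on f by composition with its own inverse: coordinate
    functions are multiplied by 2. *)
Definition dilation : grp R n := (1%:M, (2^-1, 2^-1)).

Lemma dilation_TxGm2 : TxGm2 dilation.
Proof.
apply/TxGm2P; exists (const_mx 1), 2^-1, 2^-1.
rewrite diag_const_mx; split=> // [l||]; rewrite ?mxE ?oner_neq0 //.
  by rewrite invr_eq0 pnatr_eq0.
by rewrite invr_eq0 pnatr_eq0.
Qed.

Lemma genXY_row v : row_mx (mxvec (genX R n)) (mxvec (genY R n)) 0 v = 'X_v.
Proof.
case: (split_ordP v) => u ->; rewrite ?row_mxEl ?row_mxEr;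
  by case/mxvec_indexP: u => a b; rewrite mxvecE mxE.
Qed.

Lemma act_gen_dilation :
  act_gen dilation = 2%:MP *: row_mx (mxvec (genX R n)) (mxvec (genY R n)).
Proof.
have cE (Z : 'M[A]_n) :
    map_mx (fun c : C => c%:MP : A) (2^-1^-1 *: invmx 1%:M) *m Z
      *m map_mx (fun c : C => c%:MP : A) 1%:M = 2%:MP *: Z.
  rewrite invrK invmx1 scalemx1 (map_scalar_mx (@mpolyC _ C)).
  by rewrite (map_scalar_mx (@mpolyC _ C)) /= mpolyC1 mulmx1 mul_scalar_mx.
rewrite scale_row_mx -!linearZ /act_gen.
by congr (row_mx (mxvec _) (mxvec _)); exact: cE.
Qed.

Lemma act_coords_dilation v : tnth (act_coords dilation) v = (2 : C) *: ('X_v : A).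
Proof.
by rewrite tnth_mktuple act_gen_dilation mxE genXY_row mul_mpolyC.
Qed.

(** A monomial of degree d is multiplied by 2^d, which differs from 1 for d > 0. *)
Lemma dilation_invariant f : act_poly dilation f = f -> f = (f@_0)%:MP.
Proof.
move=> fE; apply/mpolyP => m; rewrite mcoeffC.
have [->|m0] := eqVneq m 0%MM; first by rewrite mulr1.
rewrite mulr0.
have actX k : 'X_[k] \mPo act_coords dilation = (2 ^+ mdeg k : C) *: ('X_[k] : A).
  rewrite comp_mpolyX.
  under eq_bigr do rewrite act_coords_dilation exprZn.
  by rewrite scaler_prod mpolyXE_id mdegE -(big_morph _ (exprD _) (expr0 _)).
have : f@_m = 2 ^+ mdeg m * f@_m.
  rewrite -{1}fE /act_poly /= comp_mpolyEX.
  under eq_bigr do rewrite actX scalerA mulrC -scalerA.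
  rewrite [in RHS](mpolyE f) !raddf_sum /= mulr_sumr; apply: eq_bigr => k _.
  rewrite !mcoeffZ mcoeffX; case: eqP => [->|]; rewrite ?mulr0 //.
move/eqP; rewrite -[X in X == _]mul1r -subr_eq0 -mulrBl mulf_eq0 subr_eq0.
case/orP => [|/eqP //].
rewrite eq_sym -(natrX _ 2) -[X in _ == X]/(1%:R) eqr_nat.
have : (0 < mdeg m)%N by rewrite lt0n mdeg_eq0.
by case: (mdeg m) => // k _; rewrite -[X in _ == X](expn0 2) eqn_exp2l.
Qed.

(** Each nonconstant monomial is divisible by a variable. Through this, evaluation at the origin
    computes quotients by m_0. *)
Lemma eval0_decomposition f : exists u : 'I_(n * n + n * n) -> A,
  f = (eval_at 0 0 f)%:MP + \sum_v 'X_v * u v.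
Proof.
have mnm_neq0 m : m != 0%MM -> exists v, m v != 0%N.
  by rewrite -mdeg_eq0 mdegE sum_nat_eq0 => /forallPn[v mv]; exists v.
have ev0 m : m != 0%MM -> eval_at 0 0 'X_[m] = 0.
  move=> /mnm_neq0[v mv]; rewrite [LHS]mevalX; apply/eqP/prodf_eq0; exists v => //.
  by rewrite !linear0 row_mx0 mxE expr0n (negPf mv).
elim/mpolyind: f => [|c m p _ _ [u uE]].
  by exists (fun=> 0); rewrite rmorph0 add0r big1 // => v _; rewrite mulr0.
have [m0|m0] := eqVneq m 0%MM.
  exists u; rewrite {1}uE m0 mpolyX0 alg_mpolyC !rmorphD /= eval_atC.
  by rewrite addrA.
have [v mv] := mnm_neq0 _ _ m0.
exists (fun v' => u v' + (v' == v)%:R * (c *: 'X_[m - U_(v)])).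
rewrite rmorphD /= -mul_mpolyC rmorphM /= ev0 // mulr0 add0r.
under eq_bigr do rewrite mulrDr.
rewrite big_split /= addrA -uE addrC; congr (_ + _).
rewrite (bigD1 v) //= big1 ?addr0 => [|v' /negPf ->]; last by rewrite mul0r mulr0.
rewrite eqxx mul1r -scalerAr -mpolyXD addmC submK ?mul_mpolyC //.
by rewrite lep1mP.
Qed.

End PolynomialAction.

(** * Weight decompositions *)

Lemma sum_by_key (V : nmodType) (T B : eqType) (l : seq B) (k : B -> T)
    (F : B -> V) :
  \sum_(x <- l) F x = \sum_(t <- undup (map k l)) \sum_(x <- l | k x == t) F x.
Proof.
rewrite (exchange_big_dep predT) //= big_seq [RHS]big_seq.
apply: eq_bigr => x xl; under eq_bigl do rewrite eq_sym.
by rewrite -big_filter filter_pred1_uniq ?undup_uniq ?big_seq1 // mem_undup map_f.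
Qed.

Section MonomialFunctions.
Variables (R : realType) (n : nat).
Local Notation C := R[i].
Implicit Types (phi : grp R n -> C).

(** The scalar may be 0: off-diagonal matrix entries restrict to 0 on the torus, and 0^-1 = 0 keeps
    the class closed under inverses. *)
Definition char_multiple phi := exists (c : C) (w : weight n),
  forall g, TxGm2 g -> phi g = c * chi w g.

Definition oppw (w : weight n) : weight n := (- w.1, (- w.2.1, - w.2.2)).

Lemma chiN w (g : grp R n) : TxGm2 g -> chi (oppw w) g = (chi w g)^-1.
Proof.
move=> Hg; apply: (mulIf (chi_neq0 w Hg)); rewrite mulVf ?chi_neq0 // -chiD //.
rewrite /chi /addw /oppw /= !addNr !expr0z !mul1r big1 // => l _.
by rewrite !mxE expr0z.
Qed.

Lemma chi0 (g : grp R n) : chi (0, (0, 0)) g = 1.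
Proof. by rewrite /chi /= !expr0z !mul1r big1 // => l _; rewrite mxE expr0z. Qed.

Lemma char_multiple_const c : char_multiple (fun=> c).
Proof. by exists c, (0, (0, 0)) => g _; rewrite chi0 mulr1. Qed.

Lemma char_multipleM phi psi :
  char_multiple phi -> char_multiple psi -> char_multiple (fun g => phi g * psi g).
Proof.
move=> [c [w cw]] [c' [w' cw']]; exists (c * c'), (addw w w') => g Hg.
by rewrite cw // cw' // chiD // mulrACA.
Qed.

Lemma char_multipleV phi : char_multiple phi -> char_multiple (fun g => (phi g)^-1).
Proof.
move=> [c [w cw]]; exists c^-1, (oppw w) => g Hg.
by rewrite cw // chiN // invfM.
Qed.

Lemma char_multiple_prod (I : Type) (l : seq I) (F : I -> grp R n -> C) :
  (forall v, char_multiple (F v)) -> char_multiple (fun g => \prod_(v <- l) F v g).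
Proof.
move=> FQ; elim: l => [|v l IH].
  by under eq_fun do rewrite big_nil; exact: char_multiple_const.
by under eq_fun do rewrite big_cons; exact: char_multipleM.
Qed.

Lemma char_multipleX phi k : char_multiple phi -> char_multiple (fun g => phi g ^+ k).
Proof.
move=> phiQ; elim: k => [|k IH]; first exact: char_multiple_const.
by under eq_fun do rewrite exprS; exact: char_multipleM.
Qed.

Lemma char_multiple_torus (a : 'I_n) : char_multiple (fun g => g.1 a a).
Proof.
exists 1, (\row_l (l == a)%:Z, (0, 0)) => g _; rewrite mul1r /chi /= !expr0z !mul1r.
rewrite (bigD1 a) //= big1 => [|l /negPf la]; first by rewrite mxE eqxx expr1z mulr1.
by rewrite mxE la expr0z.
Qed.

Lemma char_multiple_entry (a b : 'I_n) : char_multiple (fun g => g.1 a b).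
Proof.
have [<-|ab] := eqVneq a b; first exact: char_multiple_torus.
exists 0, (0, (0, 0)) => g [_ /is_diag_mxP dg].
by rewrite mul0r dg // (inj_eq val_inj).
Qed.

Lemma char_multiple_scaling :
  char_multiple (fun g => g.2.1) /\ char_multiple (fun g => g.2.2).
Proof.
split; [exists 1, (0, (1, 0)) | exists 1, (0, (0, 1))] => g _;
  rewrite mul1r /chi /= expr0z expr1z ?mul1r ?mulr1 big1 ?mulr1 // => l _;
  by rewrite mxE expr0z.
Qed.

Lemma char_multiple_det : char_multiple (fun g => \det g.1).
Proof.
have [c [w cw]] := char_multiple_prod (index_enum 'I_n) char_multiple_torus.
exists c, w => g Hg; rewrite -cw //; move: Hg => [_ /diag_mxP[d ->]].
by rewrite det_diag; apply: eq_bigr => l _; rewrite mxE eqxx.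
Qed.

Lemma char_multiple_monomial (m : 'X_{1..n * n + (1 + 1)}) k :
  char_multiple (fun g => regfun 'X_[m] k g).
Proof.
rewrite /regfun; have [t1Q t2Q] := char_multiple_scaling.
apply: char_multipleM.
  under eq_fun do rewrite mevalX.
  apply: char_multiple_prod => v; apply: char_multipleX.
  have [u|u] := split_ordP v.
    move=> ->; under eq_fun do rewrite row_mxEl.
    case/mxvec_indexP: u => a b; under eq_fun do rewrite mxvecE.
    exact: char_multiple_entry.
  move=> ->; under eq_fun do rewrite row_mxEr.
  have [u'|u'] := split_ordP u => ->; rewrite (ord1 u').
    by under eq_fun do rewrite row_mxEl mxE.
  by under eq_fun do rewrite row_mxEr mxE.
apply: char_multipleV; apply: char_multipleX.
by do 2?[apply: char_multipleM]; rewrite //; exact: char_multiple_det.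
Qed.

(** On the torus, each monomial of the numerator divided by the denominator is a scalar multiple of
    one character. *)
Lemma regfun_chi p k : exists s : seq (weight n * C),
  forall g, TxGm2 g -> @regfun R n p k g = \sum_(x <- s) x.2 * chi x.1 g.
Proof.
elim/mpolyind: p => [|c m p _ _ [s IH]].
  by exists [::] => g _; rewrite big_nil /regfun meval0 mul0r.
have [c' [w cw]] := char_multiple_monomial m k.
exists ((w, c * c') :: s) => g Hg; rewrite big_cons /= -IH // -mulrA -cw //.
by rewrite /regfun mevalD mevalZ mulrDl [in RHS]mulrA.
Qed.

End MonomialFunctions.

Section WeightDecomposition.
Variables (R : realType) (n : nat) (N : TsheafV R n).
Local Notation C := R[i].
Local Notation A := (polV R n).

Lemma esh_act0 g : TxGm2 g -> esh_act g (0 : N) = 0.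
Proof.
move=> Hg; apply: (addrI (esh_act g (0 : N))).
by rewrite -(esh_actD (esh_axioms N)) // !addr0.
Qed.

Lemma esh_act_sum (I : Type) (l : seq I) (F : I -> N) g : TxGm2 g ->
  esh_act g (\sum_(x <- l) F x) = \sum_(x <- l) esh_act g (F x).
Proof.
move=> Hg; elim: l => [|x l IH]; first by rewrite !big_nil esh_act0.
by rewrite !big_cons (esh_actD (esh_axioms N)) // IH.
Qed.

Lemma esh_actCZ g (c : C) (x : N) : TxGm2 g ->
  esh_act g (c%:MP *: x) = c%:MP *: esh_act g x.
Proof. by move=> Hg; rewrite (esh_actZ (esh_axioms N)) // actpolE act_polyC. Qed.

Definition weight_vector (w : weight n) (x : N) :=
  forall g, TxGm2 g -> esh_act g x = (chi w g)%:MP *: x.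

(** Rationality expands g x as a finite sum of chi_w(g) x_w. Comparing (h g) x with h (g x),
    independence of characters in g shows that x_w has weight w; g = 1 recovers x. *)
Lemma weight_decomposition (x : N) : exists l : seq (weight n * N),
  (forall y, y \in l -> weight_vector y.1 y.2) /\ x = \sum_(y <- l) y.2.
Proof.
have [r [k [e [p xE]]]] := esh_rational (esh_axioms N) x.
have [s sE] := boolp.choice (fun i => regfun_chi (p i) k).
pose l := flatten [seq [seq (y.1, y.2%:MP *: e i) | y <- s i] | i <- enum 'I_r].
have actE g : TxGm2 g -> esh_act g x = \sum_(y <- l) (chi y.1 g)%:MP *: y.2.
  move=> Hg; rewrite xE // big_flatten /= big_map big_enum /=.
  apply: eq_bigr => i _; rewrite big_map sE // rmorph_sum /= scaler_suml.
  by apply: eq_bigr => y _; rewrite scalerA -rmorphM mulrC.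
pose S := undup [seq y.1 | y <- l].
pose xw w := \sum_(y <- l | y.1 == w) y.2.
have actS g : TxGm2 g -> esh_act g x = \sum_(w <- S) (chi w g)%:MP *: xw w.
  move=> Hg; rewrite actE // (sum_by_key l fst); apply: eq_bigr => w _.
  by rewrite scaler_sumr; apply: eq_bigr => y /eqP ->.
exists [seq (w, xw w) | w <- S]; split.
  move=> _ /mapP[w wS ->] /= h Hh; apply/eqP; rewrite -subr_eq0; apply/eqP.
  move: w wS; apply: (chi_independent (io := @mpolyC _ C) (undup_uniq _)) => g Hg.
  under eq_bigr do rewrite scalerBr.
  rewrite sumrB; apply/eqP; rewrite subr_eq0; apply/eqP.
  under eq_bigr do rewrite -esh_actCZ //.
  rewrite -esh_act_sum // -actS // -(esh_actM (esh_axioms N)) //.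
  rewrite actS; last exact: TxGm2_M.
  by apply: eq_bigr => w _; rewrite chiM // scalerA -rmorphM mulrC.
rewrite big_map /= -[LHS](esh_act1 (esh_axioms N)) actS; last exact: TxGm2_1.
by apply: eq_bigr => w _; rewrite chi1 scale1r.
Qed.

End WeightDecomposition.

(** * Bases of weight vectors *)

Section Coordinates.
Variables (S : nzRingType) (M : lmodType S) (r : nat).
Variables (e : 'I_r -> M) (co : M -> 'rV[S]_r).

Definition coordinates := (forall x, x = \sum_j co x 0 j *: e j) /\
  (forall c : 'rV[S]_r, co (\sum_j c 0 j *: e j) = c).

Hypothesis coP : coordinates.

Lemma coordinates_linear a x y : co (a *: x + y) = a *: co x + co y.
Proof.
rewrite -[RHS]coP.2; congr co; rewrite {1}(coP.1 x) {1}(coP.1 y).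
rewrite scaler_sumr -big_split /=; apply: eq_bigr => j _.
by rewrite !mxE scalerDl scalerA.
Qed.

Lemma coordinates_basis j : co (e j) = delta_mx 0 j.
Proof.
rewrite -[RHS]coP.2; congr co; rewrite (bigD1 j) //= big1 => [|l /negPf lj].
  by rewrite mxE !eqxx scale1r addr0.
by rewrite mxE lj andbF scale0r.
Qed.

Lemma coordinates_inj : injective co.
Proof. by move=> x y xy; rewrite (coP.1 x) xy -coP.1. Qed.

End Coordinates.

Lemma coordinates_exist (S : nzRingType) (M : lmodType S) (r : nat) (e : 'I_r -> M) :
  (forall x, exists! c : 'rV[S]_r, x = \sum_j c 0 j *: e j) ->
  exists co, coordinates e co.
Proof.
move=> eP; have [co coE] := boolp.choice eP; exists co.
split=> [x|c]; first by case: (coE x).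
by case: (coE (\sum_j c 0 j *: e j)) => _; exact.
Qed.

Lemma coordinates_change (S : comNzRingType) (M : lmodType S) (r : nat)
    (e : 'I_r -> M) (co : M -> 'rV[S]_r) (b : 'I_r -> M) (B' : 'M[S]_r) :
  coordinates e co ->
  (\matrix_j co (b j)) *m B' = 1%:M -> B' *m (\matrix_j co (b j)) = 1%:M ->
  coordinates b (fun x => co x *m B').
Proof.
move=> coP BB' B'B.
pose co_lin : {linear M -> 'rV[S]_r} := HB.pack co
  (GRing.isLinear.Build _ _ _ _ co (coordinates_linear coP)).
have cosum (c : 'rV[S]_r) : co (\sum_j c 0 j *: b j) = c *m \matrix_j co (b j).
  rewrite -[LHS]/(co_lin _) linear_sum mulmx_sum_row; apply: eq_bigr => j _.
  by rewrite linearZ rowK.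
split=> [x|c]; last by rewrite cosum -mulmxA BB' mulmx1.
by apply: (coordinates_inj coP); rewrite cosum -mulmxA B'B mulmx1.
Qed.

Section WeightBasis.
Variables (R : realType) (n : nat) (N : TsheafV R n).
Local Notation C := R[i].
Local Notation A := (polV R n).

Record weight_basis := WeightBasis {
  wb_rank : nat;
  wb_elt : 'I_wb_rank -> N;
  wb_wt : 'I_wb_rank -> weight n;
  wb_coord : N -> 'rV[A]_wb_rank;
  wb_coordP : coordinates wb_elt wb_coord;
  wb_weight : forall j, weight_vector (wb_wt j) (wb_elt j) }.

Variables (r : nat) (e : 'I_r -> N) (co : N -> 'rV[A]_r).
Hypothesis coP : coordinates e co.

Let co_lin : {linear N -> 'rV[A]_r} := HB.pack co
  (GRing.isLinear.Build _ _ _ _ co (coordinates_linear coP)).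

Local Notation ev0 := (map_mx (eval_at (0 : 'M[C]_n) 0)).

(** The weight components of the [e j] suffice, because the [e j] themselves take the standard basis
    as values at the origin. *)
Lemma weight_vectors_span : exists (K : nat) (b : 'I_K -> N) (w : 'I_K -> weight n),
  (forall j, weight_vector (w j) (b j)) /\ row_full (\matrix_j ev0 (co (b j))).
Proof.
have [l lP] := boolp.choice (fun j => weight_decomposition (e j)).
pose L := flatten [seq l j | j <- enum 'I_r].
have LP y : y \in L -> weight_vector y.1 y.2.
  by move=> /flatten_mapP[j _]; exact: (lP j).1.
exists (size L), (fun j => (tnth (in_tuple L) j).2), (fun j => (tnth (in_tuple L) j).1).
split=> [j|]; first exact/LP/mem_tnth.
rewrite -sub1mx; apply/row_subP => j.
have -> : row j 1%:M = ev0 (co (e j)).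
  by rewrite (coordinates_basis coP) map_delta_mx row1.
rewrite [e j](lP j).2 -[co _]/(co_lin _) linear_sum /= raddf_sum big_seq.
apply: summx_sub => y yl.
have /tnthP[k yE] : y \in in_tuple L.
  by apply/flatten_mapP; exists j => //; rewrite mem_enum.
by apply: (eq_row_sub k); rewrite rowK -yE.
Qed.

Let gmx g : 'M[A]_r := \matrix_j co (esh_act g (e j)).

(** The action is only semilinear: [g] also moves the polynomial coordinates, and [gmx] is a
    cocycle. *)
Lemma coord_act g x : TxGm2 g ->
  co (esh_act g x) = map_mx (act_poly g) (co x) *m gmx g.
Proof.
move=> Hg; rewrite {1}(coP.1 x) esh_act_sum // -[co _]/(co_lin _) linear_sum.
rewrite mulmx_sum_row; apply: eq_bigr => j _.
by rewrite (esh_actZ (esh_axioms N)) // linearZ rowK mxE.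
Qed.

(** Acting by [g] after its inverse shows that [gmx g] is invertible over the polynomial ring, whose
    units are constants. *)
Lemma det_gmx g : TxGm2 g -> exists c : C, \det (gmx g) = c%:MP.
Proof.
move=> Hg; exists ((\det (gmx g))@_0).
suff : \det (gmx g) \in @mpoly_unit _ _ by case/andP => /eqP.
apply: (@mpoly_intro_unit _ _ _ (act_poly g (\det (gmx (grpV g))))).
rewrite -det_map_mx -det_mulmx -[RHS](det1 _ r); congr (\det _).
apply/row_matrixP => j; rewrite row_mul -map_row rowK -coord_act //.
rewrite -(esh_actM (esh_axioms N)) ?grpMV //; last exact: TxGm2_V.
by rewrite (esh_act1 (esh_axioms N)) (coordinates_basis coP) row1.
Qed.

(* The determinant d of weight vectors b_j in the basis e satisfies
   g.d = c_g d, and c_g = 1 when d does not vanish at the fixed point 0;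
   invariance under dilations then makes d constant. *)
Lemma weight_det_const (b : 'I_r -> N) (w : 'I_r -> weight n) :
  (forall j, weight_vector (w j) (b j)) ->
  \matrix_j ev0 (co (b j)) \in unitmx ->
  exists2 c : C, c != 0 & \det (\matrix_j co (b j)) = c%:MP.
Proof.
move=> bw Bu; set B := \matrix_j co (b j); set d := \det B.
have d0 : eval_at 0 0 d != 0.
  move: Bu; rewrite unitmxE unitfE; congr (_ != 0).
  rewrite /d -det_map_mx; congr (\det _).
  by apply/row_matrixP => j; rewrite -map_row !rowK.
have Hg := dilation_TxGm2 R n; set g := dilation R n in Hg.
have [c cE] := det_gmx Hg.
pose D : 'M[C]_r := diag_mx (\row_j chi (w j) g).
have dE : act_poly g d * c%:MP = (\det D)%:MP * d.
  have e1 : act_poly g d = \det (map_mx (act_poly g) B) by rewrite [RHS]det_map_mx.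
  have e2 : (\det D)%:MP = \det (map_mx (@mpolyC _ C) D) :> A.
    by rewrite (det_map_mx (@mpolyC _ C)).
  have eM : map_mx (act_poly g) B *m gmx g = map_mx (@mpolyC _ C) D *m B.
    apply/row_matrixP => j.
    transitivity (co (esh_act g (b j))).
      by rewrite row_mul -map_row rowK -coord_act.
    rewrite bw // -[co _]/(co_lin _) linearZ /= map_diag_mx.
    by apply/rowP => l; rewrite mxE [RHS]mxE mul_diag_mx !mxE.
  by rewrite e1 e2 -cE -[LHS]det_mulmx eM [LHS]det_mulmx.
have cD : c = \det D.
  have := congr1 (eval_at 0 0) dE; rewrite !rmorphM /= !eval_atC eval_act_poly0.
  by rewrite mulrC => /(mulIf d0).
have c0 : c != 0.
  rewrite cD det_diag; apply/prodf_neq0 => j _.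
  by rewrite mxE chi_neq0.
have : act_poly g d = d.
  have := congr1 (fun f => f * c^-1%:MP) dE; rewrite -cD [_ * d]mulrC -!mulrA.
  by rewrite -!mpolyCM mulfV // mpolyC1 !mulr1.
move=> /dilation_invariant dC; exists (d@_0); last exact: dC.
by move: d0; rewrite {1}dC eval_atC.
Qed.

(** A form of graded Nakayama: weight vectors that give a basis of the fibre at the origin have
    constant nonzero determinant, so the adjugate yields a polynomial inverse of the transition
    matrix. The trailing [True] turns inhabitation of a record type into a proposition. *)
Lemma weight_basis_exists : exists W : weight_basis, True.
Proof.
have [K [b [w [bw bfull]]]] := weight_vectors_span.
pose f := fullrankfun bfull.
have bu : \matrix_j ev0 (co (b (f j))) \in unitmx.
  have := fullrowsub_unit bfull; congr (_ \in unitmx).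
  by apply/row_matrixP => j; rewrite row_rowsub !rowK.
have [c c0 cE] := weight_det_const (fun j => bw (f j)) bu.
set B := \matrix_j co (b (f j)) in cE.
have cc : (c^-1)%:MP * c%:MP = 1 :> A by rewrite -mpolyCM mulVf.
have coP' := @coordinates_change _ _ _ _ _ (b \o f) ((c^-1)%:MP *: \adj B) coP.
unshelve eexists (@WeightBasis r (b \o f) (w \o f) _ (coP' _ _) _) => //.
- by rewrite -scalemxAr -/B mul_mx_adj cE scale_scalar_mx cc.
- by rewrite -scalemxAl -/B mul_adj_mx cE scale_scalar_mx cc.
- by move=> j; exact: bw.
Qed.

End WeightBasis.

(** * Resolutions *)

Section GradedTorus.
Variables (R : realType) (n : nat).
Local Notation C := R[i].

Definition chi_mx r (wt : 'I_r -> weight n) (g : grp R n) : 'M[C]_r :=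
  diag_mx (\row_j chi (wt j) g).

Lemma graded_chi_mx r s (wtr : 'I_r -> weight n) (wts : 'I_s -> weight n)
    (D : 'M[C]_(r, s)) g :
  graded_mx wtr wts D -> chi_mx wtr g *m D = D *m chi_mx wts g.
Proof.
move=> gr; apply/matrixP => j l; rewrite mul_diag_mx mul_mx_diag !mxE mulrC.
by have [->|/gr->] := eqVneq (D j l) 0; rewrite ?mul0r.
Qed.

Lemma wtproj_chi_mx r (wt : 'I_r -> weight n) w g :
  wtproj C wt w *m chi_mx wt g = chi w g *: wtproj C wt w.
Proof.
apply/matrixP => j l; rewrite mul_diag_mx !mxE.
by have [->|] := eqVneq (wt j) w; rewrite /= ?mul0r ?mul0rn ?mulr0 // mul1r mulr_natr.
Qed.

Lemma sum_wtproj r (wt : 'I_r -> weight n) (S : seq (weight n)) (f : weight n -> C) :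
  uniq S -> (forall j, wt j \in S) ->
  \sum_(t <- S) f t *: wtproj C wt t = diag_mx (\row_j f (wt j)).
Proof.
move=> uS wtS; apply/matrixP => j l; rewrite summxE !mxE.
under eq_bigr do rewrite !mxE.
rewrite (bigD1_seq (wt j)) //= big1 ?addr0 => [|t /negPf tj].
  by rewrite eqxx mulrnAr mulr1.
by rewrite eq_sym tj mul0rn mulr0.
Qed.

(** [torW] asks for weight [w] only modulo boundaries, whereas the Euler identity counts true weight
    spaces. Independence of characters in the cokernel of [D] shows that [u] and its weight-[w]
    component differ by a boundary. *)
Lemma weight_space_modulo r s (wtr : 'I_r -> weight n) (wts : 'I_s -> weight n)
    (D : 'M[C]_(r, s)) (Z : 'M[C]_s) w (u : 'rV[C]_s) :
  graded_mx wtr wts D -> (D <= Z)%MS ->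
  ((u <= Z)%MS /\ forall g, TxGm2 g -> (u *m chi_mx wts g - chi w g *: u <= D)%MS)
  <-> (u <= (wtproj C wts w :&: Z) + D)%MS.
Proof.
move=> gr DZ; split=> [[uZ ug]|/sub_addsmxP[[a b] /= ->]].
  have [S [uS wS wtsS]] : exists S, [/\ uniq S, w \in S & forall j, wts j \in S].
    exists (undup (w :: [seq wts j | j <- enum 'I_s])).
    split=> [||j]; rewrite ?undup_uniq ?mem_undup ?mem_head //.
    by rewrite inE map_f ?mem_enum ?orbT.
  (* With u_t the weight-t component of u, the hypothesis says that the sum over t of chi_t(g) (u_t
     - [t = w] u) vanishes modulo [D]. *)
  pose m t := (u *m wtproj C wts t - (t == w)%:R *: u) *m cokermx D.
  have /(_ w wS) : forall t, t \in S -> m t = 0.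
    apply: (chi_independent (io := idfun) uS) => g Hg /=.
    under eq_bigr do rewrite scalemxAl scalerBr scalemxAr.
    rewrite -mulmx_suml sumrB -mulmx_sumr sum_wtproj //.
    rewrite (bigD1_seq w) //= big1 ?addr0 => [|t /negPf ->].
      by rewrite eqxx scale1r; apply/eqP; rewrite -submxE ug.
    by rewrite scale0r scaler0.
  rewrite /m eqxx scale1r => /eqP; rewrite -submxE => uD.
  rewrite -[X in (X <= _)%MS](subKr (u *m wtproj C wts w)) addmx_sub //; last first.
    by rewrite eqmx_opp; apply: submx_trans uD (addsmxSr _ _).
  apply: submx_trans (addsmxSl _ _); rewrite sub_capmx submxMl /=.
  by rewrite -(subrK u (u *m _)) addmx_sub // (submx_trans uD).
set v := a *m _; have vEZ : (v <= wtproj C wts w :&: Z)%MS by exact: submxMl.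
have /andP[vE vZ] : (v <= wtproj C wts w)%MS && (v <= Z)%MS by rewrite -sub_capmx.
split=> [|g Hg]; first by rewrite addmx_sub // (submx_trans _ DZ) ?submxMl.
move: vE; rewrite sub_wtproj => /eqP vE.
rewrite mulmxDl scalerDr -{1}vE -mulmxA wtproj_chi_mx -scalemxAr vE.
rewrite opprD addrACA subrr add0r addmx_sub //.
  by rewrite -mulmxA -(graded_chi_mx _ gr) mulmxA submxMl.
by rewrite eqmx_opp scalemx_sub // submxMl.
Qed.

End GradedTorus.

Lemma row_scale_mx1 (S : pzRingType) r (f : S) (j : 'I_r) :
  row j f%:M = f *: delta_mx 0 j.
Proof. by rewrite -scalemx1 linearZ /= row1. Qed.

(** * Differentials of a resolution in weight bases, and their fibres *)

Section ResolutionMatrices.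
Variables (R : realType) (n : nat) (M : TsheafV R n) (P : resolution M).
Local Notation C := R[i].
Local Notation A := (polV R n).

Lemma res_weight_basis i : exists W : weight_basis (res_obj P i), True.
Proof.
have [r [e /coordinates_exist[co coP]]] := res_free P i.
exact: weight_basis_exists coP.
Qed.

Definition res_basis i : weight_basis (res_obj P i) := projT1 (cid (res_weight_basis i)).

Local Notation rk i := (wb_rank (res_basis i)).
Local Notation elt i := (@wb_elt _ _ _ (res_basis i)).
Local Notation wt i := (@wb_wt _ _ _ (res_basis i)).
Local Notation coord i := (@wb_coord _ _ _ (res_basis i)).
Local Notation coordP i := (wb_coordP (res_basis i)).

Definition coord_lin i : {linear res_obj P i -> 'rV[A]_(rk i)} := HB.pack (coord i)
  (GRing.isLinear.Build _ _ _ _ (coord i) (coordinates_linear (coordP i))).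

Definition res_mx i : 'M[A]_(rk i.+1, rk i) :=
  \matrix_j coord_lin i (res_d P i (elt i.+1 j)).

Lemma coord_res_d i x : coord_lin i (res_d P i x) = coord_lin i.+1 x *m res_mx i.
Proof.
rewrite {1}((coordP i.+1).1 x) !linear_sum mulmx_sum_row; apply: eq_bigr => j _.
by rewrite !linearZ rowK.
Qed.

Lemma coord_linZ i (f : A) x : coord_lin i (f *: x) = f *: coord_lin i x.
Proof. exact: linearZ. Qed.

Lemma coord_lin_surj i u : exists x, coord_lin i x = u.
Proof. by exists (\sum_j u 0 j *: elt i j); exact: (coordP i).2. Qed.

Lemma coord_lin_inj i : injective (coord_lin i).
Proof. exact: coordinates_inj (coordP i). Qed.

Lemma coord_lin_elt i j : coord_lin i (elt i j) = delta_mx 0 j.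
Proof. exact: coordinates_basis (coordP i) j. Qed.

Lemma res_mxM i : res_mx i.+1 *m res_mx i = 0.
Proof.
apply/row_matrixP => j; rewrite row_mul rowK -coord_res_d row0.
by rewrite (@res_exact _ _ _ P i _).2 ?linear0 //; eexists.
Qed.

Lemma res_rank0 i : (res_len P < i)%N -> rk i = 0%N.
Proof.
move=> /(res_bounded (r := P)) x0; case E: (rk i) => [//|k].
have [j _] : exists j : 'I_(rk i), True by rewrite E; exists ord0.
have := coord_lin_elt j; rewrite (x0 (elt i j)) linear0 => /rowP /(_ j) /eqP.
by rewrite !mxE !eqxx eq_sym oner_eq0.
Qed.

(** Equivariance of the differential, read in weight bases: each entry is a semi-invariant whose
    character is the row weight divided by the column weight. *)
Lemma res_mx_weight i j l g : TxGm2 g ->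
  act_poly g (res_mx i j l) * (chi (wt i l) g)%:MP = (chi (wt i.+1 j) g)%:MP * res_mx i j l.
Proof.
move=> Hg; have coordE x : coord_lin i (esh_act g x) 0 l
    = act_poly g (coord_lin i x 0 l) * (chi (wt i l) g)%:MP.
  rewrite {1}((coordP i).1 x) esh_act_sum // linear_sum summxE.
  have actE l' : coord_lin i (esh_act g (coord i x 0 l' *: elt i l')) 0 l =
      act_poly g (coord_lin i x 0 l') * (chi (wt i l') g)%:MP * (l == l')%:R.
    rewrite (esh_actZ (esh_axioms _)) // (@wb_weight _ _ _ (res_basis i)) //.
    by rewrite actpolE !coord_linZ coord_lin_elt !mxE mulrA.
  rewrite (bigD1 l) // actE eqxx mulr1 big1 => [|l' /negPf ll'].
    exact: addr0.
  by rewrite actE eq_sym ll' mulr0.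
have rE : res_mx i j l = coord_lin i (res_d P i (elt i.+1 j)) 0 l by rewrite mxE.
rewrite rE -coordE.
rewrite -(@res_d_equiv _ _ _ P i) // (@wb_weight _ _ _ (res_basis i.+1)) //.
by rewrite linearZ coord_linZ mxE.
Qed.

Section Evaluation.
Variables (X Y : 'M[C]_n).

Definition res_mx_at i : 'M[C]_(rk i.+1, rk i) := map_mx (eval_at X Y) (res_mx i).

Lemma res_mx_atM i : res_mx_at i.+1 *m res_mx_at i = 0.
Proof. by rewrite -map_mxM res_mxM map_mx0. Qed.

(** At a fixed point of [g], semi-invariance equates two multiples of one number, which cancels when
    nonzero. *)
Lemma res_mx_at_weight i j l g : TxGm2 g ->
  X *m g.1 = g.2.1 *: g.1 *m X -> Y *m g.1 = g.2.2 *: g.1 *m Y ->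
  res_mx_at i j l != 0 -> chi (wt i.+1 j) g = chi (wt i l) g.
Proof.
move=> Hg Xg Yg; rewrite mxE => nz.
have := congr1 (eval_at X Y) (res_mx_weight j l Hg).
rewrite !(rmorphM (eval_at X Y)) !eval_atC eval_act_poly_fixed // mulrC => /esym.
exact: (mulIf nz).
Qed.

(* f kills M, so multiplication by f is null-homotopic on the resolution: H is the
   homotopy in degree i, and Q factors through the homotopy in degree i - 1. *)
Lemma res_homotopy (f : A) i : (forall m : M, f *: m = 0) ->
  exists (H : 'M[A]_(rk i, rk i.+1)) (Q : 'M[A]_(rk i)),
    H *m res_mx i + Q = f%:M /\
    match i return 'M[A]_(rk i) -> Prop with
    | 0%N => fun Q => Q = 0
    | j.+1 => fun Q => exists H', Q = res_mx j *m H'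
    end Q.
Proof.
move=> fM; elim: i => [|i [H [Q [HQ QE]]]].
  have /boolp.choice[y yE] j : exists y, res_d P 0 y = f *: elt 0 j.
    by apply/(@res_exact0 _ _ _ P _); rewrite linearZ /= fM.
  exists (\matrix_j coord_lin 1 (y j)), 0; split=> //; rewrite addr0.
  apply/row_matrixP => j; rewrite row_mul rowK -coord_res_d yE coord_linZ.
  by rewrite coord_lin_elt row_scale_mx1.
have DQ : res_mx i *m Q = 0.
  by case: i Q QE {H HQ} => [|i] Q => [->|[H' ->]]; rewrite ?mulmx0 // mulmxA res_mxM mul0mx.
set U := f%:M - res_mx i *m H.
have UD : U *m res_mx i = 0.
  rewrite mulmxBl -mulmxA -[H *m _](addrK Q) HQ mulmxBr DQ subr0.
  by rewrite mul_scalar_mx mul_mx_scalar subrr.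
have /boolp.choice[y yE] k : exists y, coord_lin i.+1 (res_d P i.+1 y) = row k U.
  have [x xE] := coord_lin_surj (row k U).
  have [|y yx] := (@res_exact _ _ _ P i x).1; last by exists y; rewrite yx.
  by apply: coord_lin_inj; rewrite coord_res_d xE -row_mul UD row0 linear0.
exists (\matrix_k coord_lin i.+2 (y k)), (res_mx i *m H); split; last by exists H.
have -> : \matrix_k coord_lin i.+2 (y k) *m res_mx i.+1 = U.
  by apply/row_matrixP => k; rewrite row_mul rowK -coord_res_d yE.
by rewrite subrK.
Qed.

(** Cycles are killed by the part [Q] of the homotopy, so a cycle times the nonzero value of [f] is
    a boundary. *)
Lemma res_exact_at (f : A) i : (forall m : M, f *: m = 0) -> eval_at X Y f != 0 ->
  (cycles res_mx_at i <= res_mx_at i)%MS.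
Proof.
move=> fM fv; have [H [Q [HQ QE]]] := res_homotopy i fM.
set Z := cycles _ _.
have ZQ : Z *m map_mx (eval_at X Y) Q = 0.
  rewrite /Z; case: i Q QE {Z H HQ} => [|i] Q => [->|[H' ->]] /=.
    by rewrite map_mx0 mulmx0.
  by rewrite map_mxM mulmxA mulmx_ker mul0mx.
have : (eval_at X Y f *: Z <= res_mx_at i)%MS.
  rewrite -mul_mx_scalar -map_scalar_mx -HQ map_mxD map_mxM mulmxDr ZQ addr0.
  by rewrite mulmxA submxMl.
by rewrite eqmx_scale.
Qed.

End Evaluation.

Local Notation D0 := (res_mx_at 0 0).

Lemma graded_res_mx_at0 i : graded_mx (wt i.+1) (wt i) (D0 i).
Proof.
move=> j l nz; apply: chi_inj => g Hg.
by apply: (res_mx_at_weight Hg _ _ nz); rewrite mul0mx mulmx0.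
Qed.

Definition fibre i : {additive res_obj P i -> 'rV[C]_(rk i)} :=
  map_mx (eval_at 0 0) \o coord_lin i.

Lemma fibreE i x : fibre i x = map_mx (eval_at 0 0) (coord_lin i x).
Proof. by []. Qed.

Lemma fibreZ i (f : A) x : fibre i (f *: x) = eval_at 0 0 f *: fibre i x.
Proof. by rewrite !fibreE coord_linZ map_mxZ. Qed.

Lemma fibre_surj i u : exists x, fibre i x = u.
Proof.
have [x xE] := coord_lin_surj (i := i) (map_mx (@mpolyC _ C) u).
by exists x; rewrite fibreE xE; apply/rowP => j; rewrite !mxE eval_atC.
Qed.

Lemma fibre_res_d i x : fibre i (res_d P i x) = fibre i.+1 x *m D0 i.
Proof. by rewrite !fibreE coord_res_d map_mxM. Qed.

Lemma fibre_act i x g : TxGm2 g ->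
  fibre i (esh_act g x) = fibre i x *m chi_mx (wt i) g.
Proof.
move=> Hg; rewrite {1}((coordP i).1 x) esh_act_sum // raddf_sum.
rewrite [fibre i x]row_sum_delta mulmx_suml; apply: eq_bigr => j _.
rewrite (esh_actZ (esh_axioms _)) // (@wb_weight _ _ _ (res_basis i)) // actpolE.
rewrite !fibreZ eval_act_poly0 eval_atC fibreE coord_lin_elt map_delta_mx.
rewrite -scalemxAl !mxE; congr (_ *: _).
apply/rowP => l; rewrite mul_mx_diag !mxE eqxx /=.
by case: eqP => [->|_]; rewrite ?mulr1 ?mul1r ?mulr0 ?mul0r.
Qed.

Lemma maxideal_fibre i (x : res_obj P i) : maxideal_mul x <-> fibre i x = 0.
Proof.
split=> [[u ->]|x0].
  rewrite raddf_sum big1 // => v _; rewrite fibreZ.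
  suff -> : eval_at 0 0 'X_v = 0 :> C by rewrite scale0r.
  by rewrite [LHS]mevalXU !linear0 row_mx0 mxE.
have [u uE] := boolp.choice (fun j => eval0_decomposition (coord_lin i x 0 j)).
exists (fun v => \sum_j u j v *: elt i j); rewrite {1}((coordP i).1 x).
under [RHS]eq_bigr do rewrite scaler_sumr.
rewrite exchange_big; apply: eq_bigr => j _ /=.
under [RHS]eq_bigr do rewrite scalerA.
rewrite -scaler_suml; congr (_ *: _).
rewrite -[LHS]/(coord_lin i x 0 j) uE.
by move/rowP/(_ j): x0; rewrite !mxE => ->; rewrite rmorph0 add0r.
Qed.

Lemma torZ_fibre i x : @torZ _ _ _ P i x <-> (fibre i x <= cycles D0 i)%MS.
Proof.
case: i x => [|i] x; first by rewrite /= submx1.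
split=> [/maxideal_fibre|/sub_kermxP xD].
  by rewrite fibre_res_d => xD; apply/sub_kermxP.
by apply/maxideal_fibre; rewrite fibre_res_d.
Qed.

Lemma torB_fibre i x : @torB _ _ _ P i x <-> (fibre i x <= D0 i)%MS.
Proof.
split=> [[y /maxideal_fibre]|/submxP[u xE]].
  by rewrite raddfB fibre_res_d => /subr0_eq ->; exact: submxMl.
have [y yE] := fibre_surj u; exists y; apply/maxideal_fibre.
by rewrite raddfB fibre_res_d yE xE subrr.
Qed.

Lemma torW_fibre i w x : @torW _ _ _ P i w x <->
  (fibre i x <= (wtproj C (wt i) w :&: cycles D0 i) + D0 i)%MS.
Proof.
have [W1 W2] := weight_space_modulo w (fibre i x) (@graded_res_mx_at0 i)
  (boundary_sub_cycles (@res_mx_atM 0 0) i).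
have torBE g : TxGm2 g -> torB (esh_act g x - (chi w g)%:MP *: x) <->
    (fibre i x *m chi_mx (wt i) g - chi w g *: fibre i x <= D0 i)%MS.
  by move=> Hg; have := torB_fibre (esh_act g x - (chi w g)%:MP *: x);
    rewrite raddfB fibre_act // fibreZ eval_atC.
split=> [[/torZ_fibre xZ xg]|/W2[/torZ_fibre xZ xg]]; [apply: W1|]; split=> // g Hg;
  by apply/torBE => //; exact: xg.
Qed.

Lemma dimq_tor i w :
  dimq (@torW _ _ _ P i w) (@torB _ _ _ P i) = homology_dim (fun i => wt i) D0 i w.
Proof.
rewrite (dimq_rank _ (@fibre_surj i) (@torW_fibre i w) (@torB_fibre i)) ?addsmxSr //.
  rewrite /homology_dim.
  have DZ : (D0 i <= cycles D0 i)%MS by exact: boundary_sub_cycles (@res_mx_atM 0 0) i.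
  have -> : \rank (wtproj C (wt i) w :&: D0 i)%MS =
      \rank ((wtproj C (wt i) w :&: cycles D0 i) :&: D0 i)%MS.
    rewrite -(capmxA _ _ (D0 i)); apply: eqmx_rank; apply/andP.
    by split; apply: capmxS; rewrite ?(capmx_idPr DZ).
  (* The rank of the triple intersection is added to both sides of the subtraction so that the
     dimension formula for a sum applies. *)
  rewrite -(subnDr (\rank ((wtproj C (wt i) w :&: cycles D0 i) :&: D0 i)%MS)).
  by rewrite mxrank_sum_cap [X in (X - _)%N]addnC subnDl.
by move=> c x; rewrite fibreZ eval_atC.
Qed.

Lemma tor_euler_weights : tor_euler P =
  \sum_(0 <= i < (res_len P).+1) (-1) ^+ i * (\sum_j lmono (wt i j)).
Proof.
pose S := undup (flatten [seq [seq wt i j | j <- enum 'I_(rk i)]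
                         | i <- iota 0 (res_len P).+1]).
have uS : uniq S by exact: undup_uniq.
have wtS i j : (i <= res_len P)%N -> wt i j \in S.
  move=> iL; rewrite mem_undup; apply/flatten_mapP; exists i.
    by rewrite mem_iota.
  by rewrite map_f ?mem_enum.
rewrite (euler_homology graded_res_mx_at0 (@res_mx_atM 0 0) _ _ uS wtS);
  last exact: res_rank0.
apply: eq_big_nat => i /andP[_ iL]; congr (_ * _).
rewrite /tor_char; under eq_fsbigr do rewrite dimq_tor.
(* The sum over all weights is carried by [S]: a weight outside it has no basis vector in degree
   [i], hence no homology there. *)
rewrite (@fsbigE _ _ _ _ _ S) //.
  by apply: eq_bigl => t; rewrite in_setT.
move=> t _ tS; have := card_homology_dim graded_res_mx_at0 (@res_mx_atM 0 0) i t.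
rewrite eq_card0 => [|j]; last first.
  by rewrite inE; apply: contraNF tS => /eqP <-; exact: wtS.
by move/esym/eqP; rewrite !addn_eq0 => /andP[/andP[/eqP-> _] _]; rewrite mulr0n.
Qed.

End ResolutionMatrices.

(** * The ideal and the subtorus *)

Section Ideal2.
Variables (B : comNzRingType) (f g : B).

Lemma ideal2_0 : ideal2 f g 0.
Proof. by exists 0, 0; rewrite !mul0r addr0. Qed.

Lemma ideal2D x y : ideal2 f g x -> ideal2 f g y -> ideal2 f g (x + y).
Proof.
move=> [a [b ->]] [a' [b' ->]]; exists (a + a'), (b + b').
by rewrite !mulrDl addrACA.
Qed.

Lemma ideal2M c x : ideal2 f g x -> ideal2 f g (c * x).
Proof. by move=> [a [b ->]]; exists (c * a), (c * b); rewrite mulrDr !mulrA. Qed.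

Lemma ideal2_sub0 x y : y = 0 -> ideal2 f g (x - y) -> ideal2 f g x.
Proof. by move=> ->; rewrite subr0. Qed.

Lemma ideal2_sum (I : Type) (l : seq I) (Pr : pred I) (F : I -> B) :
  (forall x, Pr x -> ideal2 f g (F x)) -> ideal2 f g (\sum_(x <- l | Pr x) F x).
Proof. by move=> FI; elim/big_ind: _ => //; [exact: ideal2_0 | exact: ideal2D]. Qed.

End Ideal2.

(** * Laurent monomials as characters *)

Section LaurentMonomials.
Variable n : nat.
Implicit Types w : weight n.

Lemma ratvar_neq0 (i : 'I_(2 + n)) : ratvar i != 0.
Proof. exact: mpolyX_frac_neq0. Qed.

Lemma lmonoD w w' : lmono (addw w w') = lmono w * lmono w'.
Proof.
apply: val_inj => /=; rewrite /ratmono /= !expfzDr ?ratvar_neq0 //.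
rewrite [RHS]mulrACA -big_split /=; congr (_ * _); first by rewrite mulrACA.
by apply: eq_bigr => l _; rewrite !mxE expfzDr ?ratvar_neq0.
Qed.

Lemma lmono0 : lmono (0, (0, 0) : int * int) = 1 :> laurent n.
Proof.
apply: val_inj => /=; rewrite /ratmono /= !expr0z !mul1r big1 // => l _.
by rewrite mxE expr0z.
Qed.

Definition zwt (a : 'I_n) : weight n := (\row_l (l == a)%:Z, (0, 0)).

Lemma lmono_zwt a : lmono (zwt a) = zvar a.
Proof.
apply: val_inj => /=; rewrite /ratmono /= !expr0z !mul1r (bigD1 a) //=.
rewrite big1 => [|l /negPf la]; first by rewrite mxE eqxx expr1z mulr1.
by rewrite mxE la expr0z.
Qed.

Lemma lmono_q1 : lmono ((0, (1, 0)) : weight n) = q1 n.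
Proof.
apply: val_inj => /=; rewrite /ratmono /= expr0z expr1z mulr1 big1 ?mulr1 // => l _.
by rewrite mxE expr0z.
Qed.

Lemma lmono_q2 : lmono ((0, (0, 1)) : weight n) = q2 n.
Proof.
apply: val_inj => /=; rewrite /ratmono /= expr0z expr1z mul1r big1 ?mulr1 // => l _.
by rewrite mxE expr0z.
Qed.

Lemma addwN w : addw (oppw w) w = (0, (0, 0)).
Proof. by rewrite /addw /= !addNr. Qed.

Lemma lmonoN w : lmono (oppw w) * lmono w = 1.
Proof. by rewrite -lmonoD addwN lmono0. Qed.

Lemma chi_zwt (R : realType) a (g : grp R n) : chi (zwt a) g = g.1 a a.
Proof.
rewrite /chi /= !expr0z !mul1r (bigD1 a) //=.
rewrite big1 => [|l /negPf la]; first by rewrite mxE eqxx expr1z mulr1.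
by rewrite mxE la expr0z.
Qed.

End LaurentMonomials.

(** * Normal form of weights on the subtorus *)

Section WheelSubtorus.
Variables (n : nat) (i j k : 'I_n).

Local Notation lattice := ('rV[int]_n * (int * int))%type.

(* The weights of q_1 z_j / z_k and q_2 z_i / z_j, which cut out the subtorus. *)
Definition root1 : weight n := addw (oppw (zwt k)) (addw (0, (1, 0)) (zwt j)).
Definition root2 : weight n := addw (oppw (zwt j)) (addw (0, (0, 1)) (zwt i)).

(** The combination of the roots with the same exponents of q_1 and q_2 as [w]. The notation
    [lattice] restores the additive structure, since [weight] is declared as a [choiceType]. *)
Definition root_comb (w : weight n) : weight n :=
  (root1 : lattice) *~ w.2.1 + (root2 : lattice) *~ w.2.2.

(** The substitution q_1 = z_k / z_j, q_2 = z_j / z_i, performed on exponents. *)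
Definition reduce (w : weight n) : weight n := addw w (oppw (root_comb w)).

Lemma addw_reduce w : addw (reduce w) (root_comb w) = w.
Proof. exact: (subrK (root_comb w : lattice) (w : lattice)). Qed.

(** One induction serves both senses in which a root is trivial: its monomial is 1 modulo the ideal,
    and its character is 1 on the subtorus. *)
Lemma root_comb_ind (Pr : weight n -> Prop) w :
  Pr (0, (0, 0)) -> (forall u v, Pr u -> Pr v -> Pr (addw u v)) ->
  (forall u, Pr u -> Pr (oppw u)) -> Pr root1 -> Pr root2 -> Pr (root_comb w).
Proof.
move=> P0 PD PN P1 P2.
have Pz (d : lattice) (z : int) : Pr d -> Pr (d *~ z).
  move=> Pd; have Pn m : Pr (d *+ m).
    by elim: m => [|m IH]; [exact: P0 | rewrite mulrS; exact: PD].
  by case: z => m; [exact: Pn | exact: PN (Pn m.+1)].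
by apply: PD; exact: Pz.
Qed.

Lemma reduce_scaling w : (reduce w).2 = (0, 0).
Proof.
have fst_mulz (U V : zmodType) (x : U * V) z : (x *~ z).1 = x.1 *~ z.
  exact: (raddfMz (@fst U V)).
have snd_mulz (U V : zmodType) (x : U * V) z : (x *~ z).2 = x.2 *~ z.
  exact: (raddfMz (@snd U V)).
have mulzE (a b z : int) : ((a, b) : int * int) *~ z = (a *~ z, b *~ z).
  by rewrite [LHS]surjective_pairing fst_mulz snd_mulz.
have combE : (root_comb w).2 = w.2.
  rewrite -[LHS]/(((root1 : lattice) *~ w.2.1).2 + ((root2 : lattice) *~ w.2.2).2).
  rewrite !snd_mulz /root1 /root2 /addw /oppw /= !oppr0 !addr0 !add0r !mulzE.
  case: w => a [b1 b2] /=; rewrite !mul0rz !intz.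
  by congr pair; rewrite ?addr0 ?add0r.
rewrite /reduce; move: (root_comb w) combE => v vE.
by rewrite /addw /oppw /= vE !subrr.
Qed.

Lemma lmono_reduce w :
  ideal2 (zvar k - q1 n * zvar j) (zvar j - q2 n * zvar i)
    (lmono w - lmono (reduce w)).
Proof.
set J := ideal2 _ _.
rewrite -{1}(addw_reduce w) lmonoD -{2}[lmono (reduce w)]mulr1 -mulrBr.
apply: ideal2M.
apply: (root_comb_ind (Pr := fun u => J (lmono u - 1))).
- by rewrite lmono0 subrr; exact: ideal2_0.
- move=> u v Ju Jv; rewrite lmonoD.
  have -> : lmono u * lmono v - 1 = lmono u * (lmono v - 1) + (lmono u - 1).
    by rewrite mulrBr mulr1 addrA subrK.
  by apply: ideal2D => //; exact: ideal2M.
- move=> u Ju; have -> : lmono (oppw u) - 1 = - lmono (oppw u) * (lmono u - 1).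
    by rewrite mulrBr mulr1 opprK mulNr lmonoN addrC.
  exact: ideal2M.
(* q_1 z_j / z_k - 1 = - z_k^-1 (z_k - q_1 z_j), and similarly for the second root. *)
- exists (- lmono (oppw (zwt k))), 0.
  rewrite mul0r addr0 !lmonoD lmono_q1 -(lmonoN (zwt k)) !lmono_zwt.
  by rewrite mulNr mulrBr opprB.
- exists 0, (- lmono (oppw (zwt j))).
  rewrite mul0r add0r !lmonoD lmono_q2 -(lmonoN (zwt j)) !lmono_zwt.
  by rewrite mulNr mulrBr opprB.
Qed.

Variable R : realType.
Local Notation C := R[i].

Definition wheel (g : grp R n) :=
  [/\ TxGm2 g, g.2.1 * g.1 j j = g.1 k k & g.2.2 * g.1 i i = g.1 j j].

Lemma chi_reduce w g : wheel g -> chi (reduce w) g = chi w g.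
Proof.
move=> [Hg gk gj]; rewrite -{2}(addw_reduce w) chiD //.
suff -> : chi (root_comb w) g = 1 by rewrite mulr1.
have scal : chi ((0, (1, 0)) : weight n) g = g.2.1 /\
    chi ((0, (0, 1)) : weight n) g = g.2.2.
  by split; rewrite /chi /= expr0z expr1z ?mul1r ?mulr1 big1 ?mulr1 // => l _;
    rewrite mxE expr0z.
apply: (root_comb_ind (Pr := fun u => chi u g = 1)).
- exact: chi0.
- by move=> u v u1 v1; rewrite chiD // u1 v1 mulr1.
- by move=> u u1; rewrite chiN // u1 invr1.
- by rewrite !chiD // chiN // !chi_zwt scal.1 gk mulVf ?TxGm2_diag_neq0.
- by rewrite !chiD // chiN // !chi_zwt scal.2 gj mulVf ?TxGm2_diag_neq0.
Qed.

Lemma reduce_eq w w' : (forall g, wheel g -> chi w g = chi w' g) ->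
  reduce w = reduce w'.
Proof.
move=> ww'; apply: (@chi_inj R) => g Hg.
(* The point of the subtorus lying above the T_n-component of [g]; reduced weights see only that
   component. *)
pose g' : grp R n := (g.1, (g.1 k k / g.1 j j, g.1 j j / g.1 i i)).
have g'W : wheel g'.
  split; rewrite /= ?divfK ?TxGm2_diag_neq0 //.
  move: (TxGm2_diag_neq0 i Hg) (TxGm2_diag_neq0 j Hg) (TxGm2_diag_neq0 k Hg).
  move: @g' Hg => g' [[gu _ _] gd] gi gj gk.
  by split=> //; split=> //=; rewrite mulf_neq0 ?invr_eq0.
have chig w0 : chi (reduce w0) g = chi (reduce w0) g'.
  by rewrite /chi reduce_scaling /= !expr0z.
by rewrite !chig !chi_reduce // ww'.
Qed.

End WheelSubtorus.

Lemma rmorph_commutator (S S' : nzRingType) (f : {rmorphism S -> S'}) n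
    (X Y : 'M[S]_n) a b :
  f ((X *m Y - Y *m X) a b) =
  (map_mx f X *m map_mx f Y - map_mx f Y *m map_mx f X) a b.
Proof. by rewrite -!map_mxM -map_mxB [RHS]mxE. Qed.

(** * The complex at the non-commuting pair *)

Section WheelConditions.
Variables (R : realType) (n : nat) (i j k : 'I_n).
Hypotheses (ij : i != j) (jk : j != k) (ik : i != k).
Local Notation C := R[i].
Local Notation X0 := (delta_mx j k : 'M[C]_n).
Local Notation Y0 := (delta_mx i j : 'M[C]_n).

(** The weights q_1 z_j / z_k of E_jk and q_2 z_i / z_j of E_ij are trivial on the subtorus. *)
Lemma wheel_fixed (g : grp R n) : wheel i j k g ->
  X0 *m g.1 = g.2.1 *: g.1 *m X0 /\ Y0 *m g.1 = g.2.2 *: g.1 *m Y0.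
Proof.
move=> [/TxGm2P[d [t1 [t2 [-> _ _ _]]]] /=]; rewrite !mxE !eqxx !mulr1n => gk gj.
split; apply/matrixP => a b; rewrite -scalemxAl mul_mx_diag [RHS]mxE mul_diag_mx !mxE.
  have [->|] := eqVneq a j; last by rewrite !mul0r !mulr0.
  by have [->|] := eqVneq b k; rewrite ?mulr0 ?mul0r // mul1r mulr1 gk.
have [->|] := eqVneq a i; last by rewrite !mul0r !mulr0.
by have [->|] := eqVneq b j; rewrite ?mulr0 ?mul0r // mul1r mulr1 gj.
Qed.

(** E_jk E_ij = 0 because k differs from i, while E_ij E_jk = E_ik. This entry is the equation that
    excludes the pair from the commuting variety. *)
Lemma commutator_at_wheel_point :
  eval_at X0 Y0 ((genX R n *m genY R n - genY R n *m genX R n) i k) = -1.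
Proof.
rewrite rmorph_commutator eval_genX eval_genY mul_delta_mx mul_delta_mx_0.
  by rewrite sub0r !mxE !eqxx.
by rewrite eq_sym.
Qed.

Lemma tor_euler_wheel (M : TsheafV R n) (P : resolution M) :
  (forall (f : polV R n) (m : M), commEqs f -> f *: m = 0) ->
  ideal2 (zvar k - q1 n * zvar j) (zvar j - q2 n * zvar i) (tor_euler P).
Proof.
move=> Mcomm; pose red := reduce i j k.
pose f : polV R n := (genX R n *m genY R n - genY R n *m genX R n) i k.
have fM (m : M) : f *: m = 0 by apply: Mcomm; exists i, k.
have fv : eval_at X0 Y0 f != 0 by rewrite commutator_at_wheel_point oppr_eq0 oner_neq0.
pose wt l := @wb_wt _ _ _ (res_basis P l).
have gr l : graded_mx (fun a => red (wt l.+1 a)) (fun a => red (wt l a))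
    (res_mx_at P X0 Y0 l).
  move=> a b nz; apply: (@reduce_eq _ _ _ _ R) => g Wg.
  have [Xg Yg] := wheel_fixed Wg; case: Wg => Hg _ _.
  exact: res_mx_at_weight nz.
pose S := undup (flatten [seq [seq red (wt l a) | a <- enum 'I_(wb_rank (res_basis P l))]
                         | l <- iota 0 (res_len P).+1]).
have uS : uniq S by exact: undup_uniq.
have redS l a : (l <= res_len P)%N -> red (wt l a) \in S.
  move=> lL; rewrite mem_undup; apply/flatten_mapP; exists l.
    by rewrite mem_iota.
  by apply/mapP; exists a; rewrite ?mem_enum.
(* For reduced weights the complex at the pair is graded and exact, so the alternating sum of the
   reduced monomials is 0 in the ring itself. Undoing the reduction costs only elements of the
   ideal. *)
have := euler_homology gr (@res_mx_atM _ _ _ P X0 Y0) (@lmono n)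
  (res_rank0 (P := P) (ltnSn _)) uS redS.
rewrite [RHS]big1 => [red0|l _]; last first.
  by rewrite big1 ?mulr0 // => t _; rewrite homology_dim0 //; exact: res_exact_at fM fv.
rewrite tor_euler_weights; apply: (ideal2_sub0 red0); rewrite -sumrB.
apply: ideal2_sum => l _; rewrite -mulrBr -sumrB; apply: ideal2M.
by apply: ideal2_sum => a _; exact: lmono_reduce.
Qed.

Lemma r0psi_wheel (x : K_T_Comm R n) :
  ideal2 (zvar k - q1 n * zvar j) (zvar j - q2 n * zvar i) (r0psi x).
Proof.
apply: ideal2_sum => -[a M] _ /=; rewrite -mulrzl; apply: ideal2M.
(* Whichever resolution [xget] selects is covered, and its default value 0 lies in the ideal. *)
rewrite /r0_pull; case: xgetP => [_ _ [P ->]|_]; last exact: ideal2_0.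
by apply: tor_euler_wheel => f m; exact: (esh_eqs (esh_axioms M)).
Qed.

End WheelConditions.

Theorem theorem2p1 (R : realType) (n : nat) (n_gt0 : (0 < n)%N) :
  (forall i j k : 'I_n, i != j -> j != k -> i != k ->
     forall x : K_T_Comm R n,
       ideal2 (zvar k - q1 n * zvar j) (zvar j - q2 n * zvar i) (r0psi x))
  /\
  (forall x : KHA R n,
     forall i j k : 'I_n, i != j -> j != k -> i != k ->
       ideal2 (zvar k - q1 n * zvar j) (zvar j - q2 n * zvar i)
         (KHA_to_SH x)).
Proof.
split=> [i j k ij jk ik x|x i j k ij jk ik]; exact: r0psi_wheel.
Qed.
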